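(* Let $\eta=(\eta_1,\dots,\eta_k)\in\mathcal{N}$. Then $\eta$ is algebraically realizable if and only if $\|\eta\|_1\equiv0\pmod 2$.
   Context: For each positive integer $n$, $\mathcal{N}_n$ is the set of all $(\eta_1,\dots,\eta_n)\in(\mathbb{Z}_{>0})^n$ with $\eta_1\le\eta_2\le\cdots\le\eta_n$, and $\mathcal{N}=\bigcup_{n=1}^\infty\mathcal{N}_n$. For $v=(v_1,\dots,v_n)\in\mathbb{R}^n$, $\|v\|_1=|v_1|+\cdots+|v_n|$. All real algebraic sets are assumed pure dimensional; a real algebraic curve is a real algebraic subset of some $\mathbb{R}^n$ of pure dimension $1$. An element $\eta\in\mathcal{N}$ is algebraically realizable if there exists an (unbounded) real algebraic curve $X\subset\mathbb{R}^n$, for some $n$, such that $k(X,\infty)=\eta$. The invariant $k(X,\infty)$. Let $\rho_\infty\colon\mathbb{S}^{n-1}\times(0,+\infty)\to\mathbb{R}^n\setminus\{0\}$, $\rho_\infty(x,r)=\frac1r x$. For an unbounded semialgebraic curve $X\subset\mathbb{R}^n$, let $X'_\infty=\overline{\rho_\infty^{-1}(X\setminus\{0\})}$ (closure in $\mathbb{S}^{n-1}\times[0,+\infty)$). Then $\partial X'_\infty=X'_\infty\cap(\mathbb{S}^{n-1}\times\{0\})$ is a finite nonempty set $\{(a_1,0),\dots,(a_r,0)\}$, where $a_1,\dots,a_r$ are the limits of $\frac{x}{\|x\|}$ along sequences in $X$ tending to infinity. Let $k_{X,\infty}(a_i,0)$ be the number of connected components of the germ of $\rho_\infty^{-1}(X\setminus\{0\})$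 at $(a_i,0)$, equivalently the number of branches of $X$ at infinity (unbounded connected components of $X$ minus a sufficiently large ball centred at $0$) along which $\frac{x}{\|x\|}\to a_i$. Order the points so that $k_{X,\infty}(a_1,0)\le\cdots\le k_{X,\infty}(a_r,0)$; then $k(X,\infty)=(k_{X,\infty}(a_1,0),\dots,k_{X,\infty}(a_r,0))$. *)

(* Defs.v *)
From HB Require Import structures.
From mathcomp Require Import all_boot all_order all_algebra.
From mathcomp Require Import all_classical all_reals all_analysis.
(* The notations of mpoly clash with those of mathcomp-analysis. *)
From mathcomp Require Import (canonicals, coercions) mpoly.
Set Implicit Arguments.
Unset Strict Implicit.
Unset Printing Implicit Defensive.
Import Order.TTheory GRing.Theory Num.Theory.
Import numFieldNormedType.Exports.
Local Open Scope classical_set_scope.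
Local Open Scope ring_scope.

Definition prime_ideal (A : comNzRingType) (P : {pred A}) : Prop :=
  idealr_closed P /\ prime_idealr_closed P.

(* A strict chain P 0 < ... < P d of prime ideals containing I, i.e. a chain
   of length d of prime ideals of the quotient ring A / I; the values P i with
   d < i are irrelevant. *)
Definition prime_chain (A : comNzRingType) (I : set A)
    (P : nat -> {pred A}) (d : nat) : Prop :=
  [/\ forall i, (i <= d)%N -> prime_ideal (P i),
      forall f, I f -> f \in P 0%N
    & forall i, (i < d)%N ->
        {subset P i <= P i.+1} /\ ~ {subset P i.+1 <= P i}].

(* The Krull dimension of A / I is d. *)
Definition quotient_krull_dim (A : comNzRingType) (I : set A) (d : nat) : Prop :=
  (exists P, prime_chain I P d) /\
  (forall e P, prime_chain I P e -> (e <= d)%N).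

Definition vanishing_ideal (R : realType) (n : nat) (A : set 'rV[R]_n) :
    set (mpoly.mpoly n R) :=
  [set p | forall x, A x -> mpoly.meval (x 0) p = 0].

(* As in Bochnak-Coste-Roy, the dimension of a semialgebraic set A is the Krull
   dimension of its ring of polynomial functions R[X_1, ..., X_n] / I(A). *)
Definition has_dim (R : realType) (n : nat) (A : set 'rV[R]_n) (d : nat) : Prop :=
  quotient_krull_dim (vanishing_ideal A) d.

Definition has_local_dim (R : realType) (n : nat) (A : set 'rV[R]_n)
    (x : 'rV[R]_n) (d : nat) : Prop :=
  \forall e \near (0 : R)^'+, has_dim (A `&` ball x e) d.

Definition pure_dim (R : realType) (n : nat) (A : set 'rV[R]_n) (d : nat) : Prop :=
  has_dim A d /\ forall x, A x -> has_local_dim A x d.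

Definition real_algebraic_set (R : realType) (n : nat) (X : set 'rV[R]_n) : Prop :=
  exists F : seq (mpoly.mpoly n R),
    X = [set x | forall p, p \in F -> mpoly.meval (x 0) p = 0].

Definition real_algebraic_curve (R : realType) (n : nat) (X : set 'rV[R]_n) : Prop :=
  real_algebraic_set X /\ pure_dim X 1.

(* The library norm on 'rV[R]_n is the sup norm. *)
Definition euclidean_norm (R : realType) (n : nat) (x : 'rV[R]_n) : R :=
  Num.sqrt (\sum_(i < n) x 0 i ^+ 2).

Definition unit_sphere (R : realType) (n : nat) : set 'rV[R]_n :=
  [set x | euclidean_norm x = 1].

Definition rho_infty (R : realType) (n : nat) (z : 'rV[R]_n * R) : 'rV[R]_n :=
  z.2^-1 *: z.1.

(* The inverse image of X \ {0} under the restriction of rho_infty to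
   S^(n-1) x (0, +oo), as a subset of R^n x R. *)
Definition rho_infty_preimage (R : realType) (n : nat) (X : set 'rV[R]_n) :
    set ('rV[R]_n * R) :=
  [set z | [/\ unit_sphere z.1, 0 < z.2 & (X `\ 0) (rho_infty z)]].

Definition strict_transform_infty (R : realType) (n : nat) (X : set 'rV[R]_n) :
    set ('rV[R]_n * R) :=
  closure (rho_infty_preimage X) `&` [set z | unit_sphere z.1 /\ 0 <= z.2].

Definition boundary_infty (R : realType) (n : nat) (X : set 'rV[R]_n) :
    set ('rV[R]_n * R) :=
  strict_transform_infty X `&` [set z | unit_sphere z.1 /\ z.2 = 0].

(* The germ of Y at p has k connected components: for all sufficiently small
   e > 0, exactly k connected components of the intersection of Y with the ball
   of radius e have p in their closure; the components not adherent to p do not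
   contribute to the germ. *)
Definition germ_components (R : realType) (V : normedModType R) (Y : set V)
    (p : V) (k : nat) : Prop :=
  \forall e \near (0 : R)^'+,
    ([set C | [set connected_component (Y `&` ball p e) y | y in Y `&` ball p e] C
              /\ closure C p] #= `I_k)%card.

(* k(X, oo) = eta, where s enumerates the points a_1, ..., a_r. *)
Definition k_infty_eq (R : realType) (n : nat) (X : set 'rV[R]_n)
    (eta : seq nat) : Prop :=
  exists s : seq 'rV[R]_n,
    [/\ uniq s,
        boundary_infty X = [set (a, 0) | a in [set` s]],
        size s = size eta,
        sorted leq eta
      & forall i, (i < size s)%N ->
          germ_components (rho_infty_preimage X) (nth 0 s i, 0 : R) (nth 0%N eta i)].

(* The set N: nonempty nondecreasing sequences of positive integers. *)
Definition calN : set (seq nat) :=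
  [set eta | [/\ (0 < size eta)%N, all (leq 1) eta & sorted leq eta]].

Definition algebraically_realizable (R : realType) (eta : seq nat) : Prop :=
  exists (n : nat) (X : set 'rV[R]_n),
    [/\ real_algebraic_curve X, ~ bounded_set X & k_infty_eq X eta].

(* The absolute values are omitted, the entries being natural numbers. *)
Definition norm1 (eta : seq nat) : nat := (\sum_(m <- eta) m)%N.

(* Main.v *)
(** On a curve X of dimension one every polynomial is algebraic over R(T), where
    T is mapped to f = |x|^2. Through a primitive element h, the points of X with
    f = c, for |c| large, correspond to the real roots of a separable polynomial
    P(c, .) whose degree does not depend on c. For c < 0 there are no such points,
    so this degree is even; hence for c > 0 large there is an even number of
    roots. They move continuously with c and are the ends of X.

    Conversely, a parabola with focus 0 has two ends in the same direction, a line
    through 0 has two ends in opposite directions, and the odd entries of a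
    sequence with even sum can be paired off by such lines. *)

Require Import Defs.
From HB Require Import structures.
From mathcomp Require Import all_boot all_order all_algebra.
From mathcomp Require Import all_classical all_reals all_analysis.
From mathcomp Require Import (canonicals, coercions) mpoly.
From mathcomp Require Import separable polyrcf ring lra zify.
Set Implicit Arguments.
Unset Strict Implicit.
Unset Printing Implicit Defensive.
Import Order.TTheory GRing.Theory Num.Theory.
Import numFieldNormedType.Exports.
Local Open Scope classical_set_scope.
Local Open Scope ring_scope.

(** * Krull dimension one and algebraic dependence *)

(** No function field is at hand: X may be reducible or have several ends, so the germs at infinity
    of functions on X form a reduced ring with zero divisors. Identities are therefore required
    along the filter of neighbourhoods of infinity in X. The minimal polynomial of a function need
    not be irreducible there; it is separable, and that is what counting roots needs. The bound on
    the dimension enters by contraposition: a coordinate independent of f would produce three nested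
    primes. The equations of X, the equation |x|^2 = c and the value of h all become polynomial
    relations in c and y modulo P. This is what carries them over to negative c, where X has no
    point. The directions of the ends converge because the ends, rescaled to the compact unit
    sphere, can accumulate at finitely many points only. In the converse, the ends in one direction
    are kept apart by the parameters 1, 2, ... of their parabolas, and the line accounts for the
    parity. *)

Section PrimeIdeals.
Variable A : comNzRingType.

Definition is_ideal (I : set A) : Prop :=
  [/\ I 0, forall x y, I x -> I y -> I (x + y) & forall a x, I x -> I (a * x)].

Lemma ideal_adjoin (I : set A) a : is_ideal I ->
  is_ideal [set z | exists m b, I m /\ z = m + b * a].
Proof.
case=> I0 ID IM; split.
- by exists 0, 0; rewrite mul0r addr0.
- move=> _ _ [m [b [Im ->]]] [m' [b' [Im' ->]]].
  by exists (m + m'), (b + b'); split; [exact: ID | rewrite mulrDl addrACA].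
- move=> c _ [m [b [Im ->]]].
  by exists (c * m), (c * b); split; [exact: IM | rewrite mulrDr mulrA].
Qed.

(** An ideal maximal among those that contain I and avoid the multiplicative set S is prime: if u
    and v lie outside it, adjoining either one meets S, and the product of the two elements of S
    found in this way would lie in the ideal if u v did. *)
Lemma exists_prime_avoiding (I S : set A) : is_ideal I -> S 1 ->
  (forall x y, S x -> S y -> S (x * y)) -> (forall x, I x -> ~ S x) ->
  exists P : {pred A}, [/\ prime_ideal P, forall x, I x -> x \in P
    & forall x, x \in P -> ~ S x].
Proof.
move=> idI S1 SM IS.
(* Zorn's lemma is applied to all chains, the empty one included; asking that J together with I be
   an ideal, instead of J itself, makes the empty union admissible. *)
pose Q := [set J : set A | is_ideal (J `|` I) /\ forall x, (J `|` I) x -> ~ S x].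
have [|J [[idM MS] Jmax]] := @Zorn_bigcup A Q.
  move=> F FQ Ftot; split; last first.
    by move=> x [[J FJ Jx]|/IS//]; apply: (FQ J FJ).2; left.
  have [I0 ID IM] := idI.
  split=> [|x y|a x]; first by right.
  - move=> [[J FJ Jx]|Ix] [[K FK Ky]|Iy].
    + have [JK|KJ] := Ftot _ _ FJ FK.
        have [_ KD _] := (FQ K FK).1.
        have [Kxy|Ixy] := KD x y (or_introl (JK _ Jx)) (or_introl Ky).
          by left; exists K.
        by right.
      have [_ KD _] := (FQ J FJ).1.
      have [Kxy|Ixy] := KD x y (or_introl Jx) (or_introl (KJ _ Ky)).
        by left; exists J.
      by right.
    + have [_ KD _] := (FQ J FJ).1.
      have [Kxy|Ixy] := KD x y (or_introl Jx) (or_intror Iy).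
        by left; exists J.
      by right.
    + have [_ KD _] := (FQ K FK).1.
      have [Kxy|Ixy] := KD x y (or_intror Ix) (or_introl Ky).
        by left; exists K.
      by right.
    + by right; exact: ID.
  - move=> [[J FJ Jx]|Ix]; last by right; exact: IM.
    have [_ _ KM] := (FQ J FJ).1.
    have [Kxy|Ixy] := KM a x (or_introl Jx); last by right.
    by left; exists J.
pose M := J `|` I.
have adj x : ~ M x -> exists m b, M m /\ S (m + b * x).
  move=> nMx; pose B := [set z | exists m b, M m /\ z = m + b * x].
  have MB : M `<=` B by move=> m Mm; exists m, 0; rewrite mul0r addr0.
  have BI : B `|` I = B.
    by apply: setUidl => z Iz; apply: MB; right.
  have M0 : M 0 by have [] := idM.
  have Bx : B x by exists 0, 1; rewrite mul1r add0r.
  have JB : J `<` B.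
    split=> [z Jz|BJ]; first by apply: MB; left.
    by apply: nMx; left; exact: BJ.
  have /not_andP [nid|nS] := Jmax B JB.
    by exfalso; apply: nid; rewrite BI; exact: ideal_adjoin.
  apply: contrapT => nex; apply: nS => z; rewrite BI => -[m [b [Mm ->]]] Sz.
  by apply: nex; exists m, b.
have [M0 MD MM] := idM.
exists (fun x => `[< M x >]); split.
- split; [split|].
  + by rewrite unfold_in; apply/asboolP.
  + by rewrite unfold_in; apply/asboolP => M1; exact: MS M1 S1.
  + move=> a u v; rewrite !unfold_in => /asboolP Mu /asboolP Mv.
    by apply/asboolP/MD => //; exact: MM.
  + move=> u v; rewrite !unfold_in => /asboolP Muv.
    have [Mu|/adj [m [b [Mm Sm]]]] := pselect (M u); first by rewrite asboolT.
    have [Mv|/adj [n [c [Mn Sn]]]] := pselect (M v); first by rewrite orbC asboolT.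
    exfalso.
    apply: MS (SM _ _ Sm Sn).
    have -> : (m + b * u) * (n + c * v) =
      (n + c * v) * m + (b * u * n + b * c * (u * v)) by ring.
    exact: (MD _ _ (MM _ _ Mm) (MD _ _ (MM _ _ Mn) (MM _ _ Muv))).
- by move=> x Ix; rewrite unfold_in; apply/asboolP; right.
- by move=> x; rewrite unfold_in => /asboolP; exact: MS.
Qed.

Section Closure.
Variables (P : {pred A}) (hP : prime_ideal P).

Lemma prime_is_ideal : is_ideal [set x | x \in P].
Proof.
case: hP => -[P0 _ Pl] _; split=> //= [x y Px Py|a x Px].
  by have := Pl 1 x y Px Py; rewrite mul1r.
by have := Pl a x 0 Px P0; rewrite addr0.
Qed.

Lemma prime_ideal1 : 1 \notin P.
Proof. by case: hP => -[]. Qed.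

Lemma prime_idealM x y : x * y \in P -> (x \in P) || (y \in P).
Proof. by case: hP => _; apply. Qed.

End Closure.
End PrimeIdeals.

Lemma realType_uncountable (R : realType) : ~ countable [set: R].
Proof.
move=> cR.
have c01 : countable `[0%R, 1%R : R]%classic by apply: sub_countable cR; exact: subset_card_le.
have := countable_lebesgue_measure0 c01.
rewrite lebesgue_measure_itv /= lte01 oppr0 adde0 => /eqP.
by rewrite onee_eq0.
Qed.

(** Polynomials of bounded degree live in a space of finite dimension; the relation is a vector of
    the left kernel of the matrix of their coefficients. *)
Lemma mpoly_bounded_dependent (K : fieldType) (n e k : nat)
    (z : 'I_k -> mpoly.mpoly n K) :
  (#|{: mpoly.bmultinom n e}| < k)%N ->
  (forall j, (mpoly.mmeasure (@mpoly.mdeg n) (z j) <= e)%N) ->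
  exists2 l : 'I_k -> K, exists j, l j != 0 & \sum_j mpoly.mpolyC n (l j) * z j = 0.
Proof.
move=> ltk ze.
pose A : 'M[K]_(k, #|{: mpoly.bmultinom n e}|) :=
  \matrix_(j, m) mpoly.mcoeff (mpoly.bmnm (enum_val m)) (z j).
have : kermx A != 0.
  rewrite kermx_eq0 /row_free eqn_leq negb_and -!ltnNge; apply/orP; right.
  by apply: leq_ltn_trans (rank_leq_col _) ltk.
move=> /rowV0Pn[v /sub_kermxP vA v0].
exists (v 0) => [|]; first by move/rV0Pn: v0.
apply/mpoly.mpolyP => m; rewrite mpoly.mcoeff0 raddf_sum /=.
have [me|me] := ltnP (mpoly.mdeg m) e; last first.
  apply: big1 => j _; rewrite mpoly.mcoeffCM mpoly.memN_msupp_eq0 ?mulr0 //.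
  by rewrite mpoly.msize_mdeg_ge // (leq_trans _ me).
move/rowP/(_ (enum_rank (mpoly.BMultinom me))): vA; rewrite !mxE => vA.
rewrite -[RHS]vA.
by apply: eq_bigr => j _; rewrite mpoly.mcoeffCM mxE enum_rankK.
Qed.

Section TranscendentalSpecialization.
Variables (R : realType) (n : nat) (L : idomainType).
Variables (psi : {rmorphism {poly L} -> mpoly.mpoly n R}).
Variables (kap : {rmorphism R -> L}).
Hypothesis psi_kap : forall c, psi (kap c)%:P = mpoly.mpolyC n c.
Variables (P : {pred mpoly.mpoly n R}) (hP : prime_ideal P).
Hypothesis psiP : forall Q, Q != 0 -> psi Q \notin P.

(* If every c failed, then 1 / (psi 'X - c) would lie in a countable union of
   finite-dimensional spaces, up to a factor in L, for uncountably many c. *)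
Lemma transcendental_specialization : exists c : R, forall (g : L) z, g != 0 ->
  psi g%:P - (psi 'X - mpoly.mpolyC n c) * z \notin P.
Proof.
apply: contrapT => noc.
have /choice[gz gzP] : forall c : R, exists gz : L * mpoly.mpoly n R, gz.1 != 0 /\
    psi gz.1%:P - (psi 'X - mpoly.mpolyC n c) * gz.2 \in P.
  move=> c; apply: contrapT => nex; apply: noc; exists c => g z g0.
  by apply/negP => gzP; apply: nex; exists (g, z).
pose dg c := mpoly.mmeasure (@mpoly.mdeg n) (gz c).2.
have [e Ae] : exists e, infinite_set [set c | (dg c <= e)%N].
  apply: contrapT => nex; apply: (@realType_uncountable R).
  have -> : [set: R] = \bigcup_e [set c | (dg c <= e)%N].
    by apply/seteqP; split=> // c _; exists (dg c) => /=.
  apply: bigcup_countable => // e _; apply: finite_set_countable.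
  by apply: contrapT => inf; apply: nex; exists e.
pose k := #|{: mpoly.bmultinom n e}|.+1.
have [B BA kB] := infinite_set_fset k Ae.
pose c (j : 'I_k) : R := nth 0 (finmap.enum_fset B) j.
have cB j : (c j \in finmap.enum_fset B) by rewrite mem_nth // (leq_trans (ltn_ord j)).
have c_inj i j : i != j -> c i != c j.
  move=> ij; rewrite /c nth_uniq ?finmap.fset_uniq //.
  - by rewrite (leq_trans (ltn_ord i)).
  - by rewrite (leq_trans (ltn_ord j)).
have [|j|l [j0 lj0] ldep] := @mpoly_bounded_dependent R n e k (fun j => (gz (c j)).2).
- by [].
- exact: (BA _ (cB j)).
(* This is the sum of the [l j * g j / ('X - c j)] with denominators cleared. At [c j0] a single
   nonzero term survives, so Q is nonzero. Modulo P each [g j] becomes [('X - c j) * z j], so the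
   image of Q becomes the full product times the vanishing sum of the [l j * z j]. *)
pose Q : {poly L} := \sum_j (kap (l j) * (gz (c j)).1)%:P *
    \prod_(i | i != j) ('X - (kap (c i))%:P).
have Q0 : Q != 0.
  apply/eqP => /(congr1 (fun p => p.[kap (c j0)])); apply/eqP.
  rewrite horner0 horner_sum (bigD1 j0) //=.
  rewrite [X in _ + X]big1 ?addr0; last first.
    move=> j jj0; rewrite hornerM horner_prod (bigD1 j0) /= 1?eq_sym //.
    by rewrite hornerXsubC subrr mul0r mulr0.
  rewrite hornerM hornerC horner_prod !mulf_neq0 ?fmorph_eq0 //.
    by case: (gzP (c j0)).
  apply/prodf_neq0 => i ij0; rewrite hornerXsubC -rmorphB fmorph_eq0 subr_eq0.
  by rewrite c_inj // eq_sym.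
have /negP := psiP Q0; apply.
have [I0 ID IM] := prime_is_ideal hP.
have -> : psi Q = \sum_j (psi (gz (c j)).1%:P -
     (psi 'X - mpoly.mpolyC n (c j)) * (gz (c j)).2) *
     (mpoly.mpolyC n (l j) * \prod_(i | i != j) (psi 'X - mpoly.mpolyC n (c i))).
  have E j : psi (\prod_(i | i != j) ('X - (kap (c i))%:P)) =
      \prod_(i | i != j) (psi 'X - mpoly.mpolyC n (c i)).
    by rewrite rmorph_prod; apply: eq_bigr => i _; rewrite rmorphB /= psi_kap.
  transitivity (\sum_j (psi (gz (c j)).1%:P * (mpoly.mpolyC n (l j) *
       \prod_(i | i != j) (psi 'X - mpoly.mpolyC n (c i))))).
    rewrite rmorph_sum; apply: eq_bigr => j _.
    by rewrite rmorphM /= E polyCM rmorphM psi_kap; ring.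
  apply/eqP; rewrite -subr_eq0 -sumrB; apply/eqP.
  transitivity ((\sum_j mpoly.mpolyC n (l j) * (gz (c j)).2) *
     \prod_i (psi 'X - mpoly.mpolyC n (c i))); last by rewrite ldep mul0r.
  rewrite mulr_suml; apply: eq_bigr => j _.
  by rewrite [\prod_i _](bigD1 j) //=; ring.
elim/big_ind: _ => // j _; rewrite mulrC; apply: IM.
by case: (gzP (c j)).
Qed.

End TranscendentalSpecialization.

Section AlgebraicDependence.
Variables (R : realType) (n : nat).
Local Notation mp := (mpoly.mpoly n R).

Lemma vanishing_ideal_ideal (X : set 'rV[R]_n) : is_ideal (vanishing_ideal X).
Proof.
split=> [x Xx|p q pX qX x Xx|a p pX x Xx].
- by rewrite rmorph0.
- by rewrite rmorphD /= pX // qX // addr0.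
- by rewrite rmorphM /= pX // mulr0.
Qed.

Definition horner2_mpoly (f a : mp) : {poly {poly R}} -> mp :=
  horner_eval a \o map_poly (horner_alg f).

HB.instance Definition _ f a := GRing.RMorphism.on (horner2_mpoly f a).

Lemma horner2_mpolyC f a g : horner2_mpoly f a g%:P = horner_alg f g.
Proof. by rewrite /horner2_mpoly /= map_polyC /= /horner_eval hornerC. Qed.

Lemma horner2_mpolyX f a : horner2_mpoly f a 'X = a.
Proof. by rewrite /horner2_mpoly /= map_polyX /horner_eval hornerX. Qed.

Lemma horner_alg_mpolyC (f : mp) (c : R) : horner_alg f c%:P = mpoly.mpolyC n c.
Proof. by rewrite horner_algC mpoly.alg_mpolyC. Qed.

Lemma meval_horner_alg (f : mp) (g : {poly R}) v :
  mpoly.meval v (horner_alg f g) = g.[mpoly.meval v f].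
Proof.
elim/poly_ind: g => [|g c IH]; first by rewrite !rmorph0 horner0.
rewrite rmorphD rmorphM /= horner_algX horner_alg_mpolyC.
by rewrite mpoly.mevalD mpoly.mevalM mpoly.mevalC IH hornerMXaddC.
Qed.

Lemma meval_horner2_mpoly (f a : mp) Q v :
  mpoly.meval v (horner2_mpoly f a Q) = Q.[(mpoly.meval v a)%:P].[mpoly.meval v f].
Proof.
elim/poly_ind: Q => [|Q c IH]; first by rewrite !rmorph0 !horner0.
rewrite rmorphD rmorphM /= horner2_mpolyX horner2_mpolyC.
rewrite mpoly.mevalD mpoly.mevalM IH meval_horner_alg.
by rewrite hornerMXaddC hornerD hornerM hornerC.
Qed.

(** If f and a were independent on X, some prime P0 over the vanishing ideal would avoid all nonzero
    polynomials in f and a. Adding a - c1, then f - c2, gives P1 and P2. The constants have to be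
    chosen with care, because for a given c the element a - c may be invertible modulo P0. *)
Lemma krull_dim1_algebraic_dependence (X : set 'rV[R]_n) (f a : mp) :
  (forall e P, prime_chain (vanishing_ideal X) P e -> (e <= 1)%N) ->
  exists2 Q : {poly {poly R}}, Q != 0 & forall x, X x ->
    Q.[(mpoly.meval (x 0) a)%:P].[mpoly.meval (x 0) f] = 0.
Proof.
move=> dimX; apply: contrapT => nodep.
pose psi : {rmorphism {poly {poly R}} -> mp} := horner2_mpoly f a.
have psiX : psi 'X = a by exact: horner2_mpolyX.
have psiC g : psi g%:P = horner_alg f g by exact: horner2_mpolyC.
pose I := vanishing_ideal X.
have [P0 [hP0 IP0 P0S]] : exists P : {pred mp}, [/\ prime_ideal P,
    forall x, I x -> x \in P &
    forall x, x \in P -> ~ [set psi Q | Q in [set Q | Q != 0]] x].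
  apply: exists_prime_avoiding.
  - exact: vanishing_ideal_ideal.
  - by exists 1; [exact: oner_neq0 | exact: rmorph1].
  - move=> _ _ [Q1 Q1n <-] [Q2 Q2n <-]; exists (Q1 * Q2); last by rewrite rmorphM.
    by rewrite /= mulf_neq0.
  - move=> x Ix [Q Qn psiQ]; apply: nodep; exists Q => // y Xy.
    by rewrite -meval_horner2_mpoly -[horner2_mpoly _ _ _]/(psi Q) psiQ Ix.
have psiP0 Q : Q != 0 -> psi Q \notin P0.
  by move=> Qn; apply/negP => /P0S; apply; exists Q.
have [|c1 c1P] := @transcendental_specialization R n {poly R} psi
    (@polyC R) _ P0 hP0 psiP0.
  by move=> c; rewrite psiC horner_alg_mpolyC.
have id0 := prime_is_ideal hP0.
have [P1 [hP1 IP1 P1S]] : exists P : {pred mp}, [/\ prime_ideal P,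
    forall x, [set z | exists m b, m \in P0 /\
      z = m + b * (a - mpoly.mpolyC n c1)] x -> x \in P &
    forall x, x \in P -> ~ [set horner_alg f g | g in [set g : {poly R} | g != 0]] x].
  apply: exists_prime_avoiding.
  - exact: ideal_adjoin id0.
  - by exists 1; [exact: oner_neq0 | exact: rmorph1].
  - move=> _ _ [Q1 Q1n <-] [Q2 Q2n <-]; exists (Q1 * Q2); last by rewrite rmorphM.
    by rewrite /= mulf_neq0.
  - move=> _ [m [b [mP0 ->]]] [g g0 gE].
    have /negP := c1P g b g0; apply.
    by rewrite psiC psiX gE mulrC addrK.
have psiP1 g : g != 0 -> horner_alg f g \notin P1.
  by move=> Qn; apply/negP => /P1S; apply; exists g.
have [|c2 c2P] := @transcendental_specialization R n R (horner_alg f)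
    idfun _ P1 hP1 psiP1.
  exact: horner_alg_mpolyC.
have id1 := prime_is_ideal hP1.
have [P2 [hP2 IP2 P2S]] : exists P : {pred mp}, [/\ prime_ideal P,
    forall x, [set z | exists m b, m \in P1 /\
      z = m + b * (f - mpoly.mpolyC n c2)] x -> x \in P &
    forall x, x \in P -> ~ [set 1] x].
  apply: exists_prime_avoiding => //.
  - exact: ideal_adjoin id1.
  - by move=> x y -> ->; rewrite mulr1.
  - move=> _ [m [b [mP1 ->]]] E.
    have mE : horner_alg f 1%:P - (horner_alg f 'X - mpoly.mpolyC n c2) * b = m.
      by rewrite horner_alg_mpolyC mpoly.mpolyC1 horner_algX -E mulrC addrK.
    have /negP := c2P 1 b (oner_neq0 _); apply.
    by rewrite -mE in mP1; exact: mP1.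
have sub01 : {subset P0 <= P1}.
  by move=> x xP; apply: IP1; exists x, 0; rewrite mul0r addr0.
have sub12 : {subset P1 <= P2}.
  by move=> x xP; apply: IP2; exists x, 0; rewrite mul0r addr0.
suff /dimX : prime_chain I
    (fun i => if i is i'.+1 then if i' is _.+1 then P2 else P1 else P0) 2 by [].
split=> [[|[|i]] //|//|[|[|//]] _ /=].
- split=> // sub; have /negP := psiP0 ('X - c1%:P%:P) (negbT (polyXsubC_eq0 _)).
  have -> : psi ('X - c1%:P%:P) = a - mpoly.mpolyC n c1.
    by rewrite rmorphB psiX psiC horner_alg_mpolyC.
  apply; apply: sub; apply: IP1; exists 0, 1; rewrite add0r mul1r.
  by split=> //; case: id0.
- split=> // sub; have /negP := psiP1 ('X - c2%:P) (negbT (polyXsubC_eq0 _)).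
  apply; apply: sub; rewrite rmorphB /= horner_algX horner_alg_mpolyC.
  by apply: IP2; exists 0, 1; rewrite add0r mul1r; split=> //; case: id1.
Qed.

End AlgebraicDependence.

(** * Minimal polynomials and primitive elements at infinity *)

Section EventualMinimalPolynomial.
Variables (E : Type) (F : set_system E) (FF : ProperFilter F).
Variables (K R0 : idomainType) (phi : E -> {rmorphism R0 -> K}) (theta : E -> K).
Hypothesis pchar0 : forall k, k.+1%:R != 0 :> R0.

Definition eventual_root (N : {poly R0}) : Prop :=
  \forall e \near F, (map_poly (phi e) N).[theta e] = 0.

Lemma eventual_rootM N1 N2 : eventual_root N2 -> eventual_root (N1 * N2).
Proof. by apply: filterS => e Ne; rewrite rmorphM hornerM Ne mulr0. Qed.

Lemma eventual_rootB N1 N2 :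
  eventual_root N1 -> eventual_root N2 -> eventual_root (N1 - N2).
Proof.
by apply: filterS2 => e N1e N2e; rewrite rmorphB hornerD hornerN N1e N2e subr0.
Qed.

Lemma eventual_rootZ c N : eventual_root N -> eventual_root (c *: N).
Proof. by move=> hN; rewrite -mul_polyC; exact: eventual_rootM. Qed.

Lemma eventual_root_sqr N : eventual_root (N ^+ 2) -> eventual_root N.
Proof.
apply: filterS => e; rewrite rmorphXn horner_exp => /eqP.
by rewrite expf_eq0 => /andP[_ /eqP].
Qed.

(* A polynomial of minimal degree with the eventual root theta is separable
   because the functions with values in K have no nilpotents. *)
Lemma eventual_minpoly : (exists2 N, N != 0 & eventual_root N) ->
  exists M, [/\ M != 0, eventual_root M, separable_poly M
    & forall Q, eventual_root Q -> exists c W, c != 0 /\ c *: Q = W * M].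
Proof.
move=> [N N0 rN].
pose size_ok k := `[< exists M, [/\ M != 0, eventual_root M & size M = k] >].
have : exists k, size_ok k by exists (size N); apply/asboolP; exists N.
case/ex_minnP => k /asboolP[M [M0 rM sM]] kmin.
have Mmin Q : Q != 0 -> eventual_root Q -> (size M <= size Q)%N.
  by move=> Q0 rQ; rewrite sM; apply: kmin; apply/asboolP; exists Q.
exists M; split=> //.
- apply/separable_polyP; split.
  + apply/poly_square_freeP => u su; apply/negP; rewrite Pdiv.Idomain.dvdp_eq.
    set c := _ ^+ _; set V := _ %/ _ => /eqP cM.
    have c0 : c != 0 by rewrite /c Pdiv.Idomain.lc_expn_scalp_neq0.
    have Vu2 : V * u ^+ 2 != 0 by rewrite -cM -mul_polyC mulf_neq0 ?polyC_eq0.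
    have [V0 u0] : V != 0 /\ u != 0.
      by move: Vu2; rewrite mulf_eq0 negb_or expf_eq0 /= => /andP[].
    (* If c M = V u^2, then V u is smaller than M, yet its square is a multiple of M, so theta is an
       eventual root of V u as well. *)
    have rVu : eventual_root (V * u).
      apply: eventual_root_sqr.
      rewrite (_ : _ ^+ 2 = V * (c *: M)); last by rewrite cM; ring.
      exact/eventual_rootM/eventual_rootZ.
    have := Mmin _ (mulf_neq0 V0 u0) rVu.
    rewrite -(size_scale M c0) cM expr2 !size_mul ?mulf_neq0 //.
    by move: su V0 u0; rewrite -!size_poly_gt0; lia.
  + move=> u _ su; have u0 : u != 0 by rewrite -size_poly_gt0 (ltn_trans _ su).
    apply/eqP => /polyP/(_ (size u).-2).
    rewrite coef_deriv coef0 => /eqP; rewrite -mulr_natr mulf_eq0.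
    case: (size u) (lead_coefE u) su => [|[|m]] //= <- _.
    by rewrite lead_coef_eq0 (negPf u0) (negPf (pchar0 _)).
- move=> Q rQ.
  have E' := Pdiv.Idomain.divp_eq Q M.
  exists (lead_coef M ^+ scalp Q M), (Q %/ M).
  rewrite expf_neq0 ?lead_coef_eq0 //; split=> //.
  rewrite E'; apply/eqP; rewrite eq_sym -subr_eq0 opprD addrA subrr add0r oppr_eq0.
  apply: contraT => r0; have := Mmin _ r0; rewrite leqNgt ltn_modp M0 /=.
  apply; have -> : Q %% M = lead_coef M ^+ scalp Q M *: Q - Q %/ M * M.
    by rewrite E' addrC addKr.
  by apply: eventual_rootB; [exact: eventual_rootZ | exact: eventual_rootM].
Qed.

End EventualMinimalPolynomial.

(** The constant D does the work of a discriminant: a specialization of the coefficients that does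
    not kill D keeps M coprime to its derivative. *)
Lemma separable_poly_bezout (R0 : idomainType) (M : {poly R0}) :
  separable_poly M -> exists a b D, D != 0 /\ a * M + b * M^`() = D%:P.
Proof.
rewrite unlock => /Bezout_coprimepP[[a b]].
rewrite -size_poly_eq1 => /size_poly1P[D D0 E].
by exists a, b, D.
Qed.

Section PolyAux.
Variable R : realType.

Lemma poly_near_pinfty_neq0 (p : {poly R}) : p != 0 ->
  \forall l \near +oo, p.[l] != 0.
Proof.
move=> p0; near=> l.
suff : l \in `[cauchy_bound p, +oo[ by move=> /(ge_cauchy_bound p0); rewrite rootE.
by rewrite in_itv /= andbT; near: l; exact: nbhs_pinfty_ge (num_real _).
Unshelve. all: by end_near. Qed.

Lemma poly_near_pinfty_eq0 (p : {poly R}) :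
  (\forall l \near +oo, p.[l] = 0) -> p = 0.
Proof.
move=> p0; apply/eqP/negPn/negP => /poly_near_pinfty_neq0 pn0.
have [x []] := filter_ex (filterI p0 pn0).
by move=> ->; rewrite eqxx.
Qed.

Lemma horner_map_polyE (A B : comNzRingType) (phi : {rmorphism A -> B}) (i : B -> A)
  (Q : {poly A}) y : phi (i y) = y -> (map_poly phi Q).[y] = phi Q.[i y].
Proof. by move=> E; rewrite -{1}E horner_map. Qed.

Lemma map_poly_horner_evalE (A : comNzRingType) (c y : A) (Q : {poly {poly A}}) :
  (map_poly (horner_eval c) Q).[y] = Q.[y%:P].[c].
Proof.
by rewrite (@horner_map_polyE _ _ (horner_eval c) polyC) //= /horner_eval hornerC.
Qed.

Lemma horner_horner (A : comNzRingType) (Q : {poly {poly A}}) (W : {poly A}) x :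
  Q.[W].[x] = (map_poly (horner_eval x) Q).[W.[x]].
Proof. by rewrite -[W.[x]]/(horner_eval x W) horner_map. Qed.

(** Chain rule for x mapped to Q(x, W(x)); differentiating the coefficients is the partial
    derivative in the inner variable. *)
Lemma deriv_horner_polyC (A : comNzRingType) (Q : {poly {poly A}}) (W : {poly A}) :
  (Q.[W])^`() = (map_poly (@deriv A) Q).[W] + W^`() * (Q^`()).[W].
Proof.
elim/poly_ind: Q => [|Q c IH]; first by rewrite deriv0 map_poly0 !horner0 deriv0 mulr0 addr0.
have -> : map_poly (@deriv A) (Q * 'X + c%:P) = map_poly (@deriv A) Q * 'X + (c^`())%:P.
  apply/polyP => i; rewrite coef_map_id0 ?deriv0 // !coefD !coefMX !coefC.
  by case: i => [|i]; rewrite /= derivD ?deriv0 // coef_map_id0 ?deriv0.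
rewrite derivD derivM derivX derivC !hornerE /= derivD derivM IH; ring.
Qed.

End PolyAux.

(** With m + 1 the degree of p and l its leading coefficient, l^m times the equation of z is a monic
    equation for l z. Algebraic elements can thus be added and multiplied as integral ones, over
    rings that are not fields. *)
Lemma integral_lead_coefM (A B : comNzRingType) (phi : {rmorphism A -> B})
    (p : {poly A}) z :
  (1 < size p)%N -> (map_poly phi p).[z] = 0 -> integralOver phi (phi (lead_coef p) * z).
Proof.
move=> sp pz; set l := lead_coef p.
have [m sE] : exists m, size p = m.+2 by case: (size p) sp => [|[|m]] // _; exists m.
pose q : {poly A} := ('X^(m.+1) + \poly_(i < m.+1) (p`_i * l ^+ (m - i))).
exists q.
  by rewrite /q monicE lead_coefDl ?lead_coefXn // size_polyXn ltnS size_poly.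
apply/eqP; rewrite /q rmorphD /= map_polyXn hornerD hornerXn.
transitivity (phi l ^+ m * (map_poly phi p).[z]); last by rewrite pz mulr0.
rewrite (@horner_coef_wide _ m.+1); last first.
  exact: leq_trans (size_poly _ _) (size_poly _ _).
rewrite (@horner_coef_wide _ m.+2); last by rewrite -sE size_poly.
rewrite [X in _ = _ * X]big_ord_recr /= mulrDr addrC; congr (_ + _).
  rewrite mulr_sumr; apply: eq_bigr => i _.
  rewrite !coef_map coef_poly ltn_ord /= rmorphM rmorphXn exprMn.
  have -> : phi l ^+ m = phi l ^+ (m - i) * phi l ^+ i.
    by rewrite -exprD subnK // -ltnS.
  by ring.
rewrite coef_map /= -[m.+1]/(m.+2.-1) -sE -lead_coefE -/l.
by rewrite sE /= exprMn [in LHS]exprS; ring.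
Qed.

Section PrimitiveElement.
Variables (R : realType) (E : pointedType) (F : set_system E) (FF : ProperFilter F).
Variable f : E -> R.
Hypothesis f_pinfty : f @ F --> +oo.

Definition eventually_algebraic (theta : E -> R) : Prop :=
  exists2 N : {poly {poly R}}, N != 0 &
    \forall e \near F, N.[(theta e)%:P].[f e] = 0.

(** Membership of g in R(f)[theta] near infinity, with denominators cleared. *)
Definition eventually_generates (theta g : E -> R) : Prop :=
  exists (d : {poly R}) (q : {poly {poly R}}), d != 0 /\
    \forall e \near F, d.[f e] * g e = q.[(theta e)%:P].[f e].

Lemma near_horner_neq0 (g : {poly R}) : g != 0 -> \forall e \near F, g.[f e] != 0.
Proof. by move=> /poly_near_pinfty_neq0 /f_pinfty. Qed.

(* Two independent large parameters: first the point e, then the real number l. *)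
Definition lex_filter : set_system (E * R) :=
  [set A | F [set e | \forall l \near +oo, A (e, l)]].

Lemma lex_filter_proper : ProperFilter lex_filter.
Proof.
split; last split.
- move=> h; have [e he] := @filter_ex _ F _ _ h.
  by have [l] := @filter_ex _ _ _ _ he.
- by apply: filterS (filterT : F setT) => e _; exact: filterT.
- by move=> A B hA hB; apply: (@filterS2 _ F _ _ _ _ _ hA hB) => e; exact: filterI.
- by move=> A B AB; apply: (@filterS _ F) => e; apply: filterS => l; exact: AB.
Qed.

Local Notation R1 := {poly {poly R}}.

Definition lex_eval (el : E * R) : R1 -> R := horner_eval (f el.1) \o horner_eval el.2%:P.
HB.instance Definition _ el := GRing.RMorphism.on (lex_eval el).

Lemma lex_evalE el D : lex_eval el D = D.[el.2%:P].[f el.1].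
Proof. by []. Qed.

(** The leading coefficient of D in l is a nonzero polynomial in f, so it is eventually nonzero
    along F; for such a point, D is a nonzero polynomial in l. This is why the point goes to
    infinity before l does. *)
Lemma near_lex_eval_neq0 (D : R1) : D != 0 ->
  \forall el \near lex_filter, lex_eval el D != 0.
Proof.
move=> D0; have := near_horner_neq0 (_ : lead_coef D != 0).
rewrite lead_coef_eq0 => /(_ D0); apply: filterS => e le.
have : map_poly (horner_eval (f e)) D != 0.
  rewrite -lead_coef_eq0 lead_coef_map_eq //.
move/poly_near_pinfty_neq0; apply: filterS => l.
by rewrite lex_evalE /= map_poly_horner_evalE.
Qed.

(** Integrality is used in the ring of all functions on [E * R], so that a single polynomial
    annihilates the function at all points at once. *)
Definition fun_eval (D : R1) : (E * R)%type -> R := fun el => lex_eval el D.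

Lemma fun_eval_is_zmod_morphism : zmod_morphism fun_eval.
Proof. by move=> x y; apply/funext => el; rewrite /fun_eval rmorphB. Qed.

Lemma fun_eval_is_monoid_morphism : monoid_morphism fun_eval.
Proof.
split; first by apply/funext => el; rewrite /fun_eval rmorph1.
by move=> x y; apply/funext => el; rewrite /fun_eval rmorphM.
Qed.

HB.instance Definition _ := GRing.isZmodMorphism.Build _ _ fun_eval fun_eval_is_zmod_morphism.
HB.instance Definition _ := GRing.isMonoidMorphism.Build _ _ fun_eval fun_eval_is_monoid_morphism.

Lemma horner_fun_eval (P : {poly R1}) (w : (E * R)%type -> R) el :
  (map_poly fun_eval P).[w] el = (map_poly (lex_eval el) P).[w el].
Proof.
elim/poly_ind: P => [|P c IH]; first by rewrite !map_poly0 !horner0.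
rewrite !rmorphD !rmorphM /= !map_polyX !map_polyC /= !hornerMXaddC.
by rewrite -IH.
Qed.

Lemma horner_map_lex_evalC (P : {poly {poly R}}) el y :
  (map_poly (lex_eval el) (map_poly polyC P)).[y] = P.[y%:P].[f el.1].
Proof.
rewrite -map_poly_comp -map_poly_horner_evalE; congr (_.[y]).
by apply: eq_map_poly => g; rewrite /= lex_evalE hornerC.
Qed.

Definition lex_morph el : {rmorphism R1 -> R} := lex_eval el.

(** Scaled by the leading coefficients of their equations, u and v become integral, hence so does
    their combination, scaled by the product of both coefficients; composing with a multiple of ['X]
    absorbs this factor. *)
Lemma lex_combination_algebraic u v :
  eventually_algebraic u -> eventually_algebraic v ->
  exists2 N : {poly R1}, N != 0 &
    eventual_root lex_filter lex_morph (fun el => u el.1 + el.2 * v el.1) N.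
Proof.
move=> [p p0 pu] [q q0 qv].
pose A e := p.[(u e)%:P].[f e] = 0 /\ q.[(v e)%:P].[f e] = 0.
(* The equations of u and v hold only eventually. The functions are replaced by 0 elsewhere, and the
   equations are multiplied by ['X], so that they hold everywhere; this also makes their degree
   positive. *)
pose cut (w : E -> R) (el : E * R) := if `[< A el.1 >] then w el.1 else 0.
have intg w (r : {poly {poly R}}) : r != 0 ->
    (forall e, A e -> r.[(w e)%:P].[f e] = 0) ->
    integralOver fun_eval (fun_eval (lead_coef r)%:P * cut w).
  move=> r0 rw; rewrite -[lead_coef r](lead_coefMX r) -(lead_coef_map_inj (@polyC_inj {poly R}) (polyC0 _)).
  apply: integral_lead_coefM.
    rewrite size_map_inj_poly ?polyC0 //; last exact: polyC_inj.
    by rewrite size_mulX // ltnS size_poly_gt0.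
  apply/funext => el; rewrite horner_fun_eval horner_map_lex_evalC hornerMX.
  rewrite hornerM hornerC /cut; case: asboolP => [/rw->|_]; last by rewrite mulr0.
  by rewrite mul0r.
have [N0 N0m N0r] : integralOver fun_eval (fun_eval (lead_coef q)%:P *
    (fun_eval (lead_coef p)%:P * cut u) + fun_eval ('X * (lead_coef p)%:P) *
    (fun_eval (lead_coef q)%:P * cut v)).
  apply: integral_add; apply: integral_mul.
  - exact: (integral_id fun_eval).
  - exact: (intg u p p0 (fun e h => h.1)).
  - exact: (integral_id fun_eval).
  - exact: (intg v q q0 (fun e h => h.2)).
pose l : R1 := (lead_coef p * lead_coef q)%:P.
have l0 : l != 0 by rewrite polyC_eq0 mulf_neq0 // lead_coef_eq0.
exists (N0 \Po (l *: 'X)).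
  rewrite comp_poly_eq0; first by rewrite monic_neq0.
  by rewrite size_scale // size_polyX.
rewrite /eventual_root; apply: (@filterS2 _ F _ _ _ _ _ pu qv) => e pue qve.
apply: nearW => r; pose el := (e, r).
have := congr1 (fun g => g el) (eqP N0r); rewrite horner_fun_eval => N0el.
rewrite map_comp_poly horner_comp /= map_polyZ map_polyX hornerZ hornerX.
rewrite -[RHS]N0el; congr (_.[_]).
rewrite -[RHS]/(lex_eval el (lead_coef q)%:P * (lex_eval el (lead_coef p)%:P * cut u el)
  + lex_eval el ('X * (lead_coef p)%:P) * (lex_eval el (lead_coef q)%:P * cut v el)).
rewrite /cut asboolT; last by split.
rewrite /l !lex_evalE -[X in X * _ = _]/((lead_coef p * lead_coef q)%:P.[r%:P].[f e]).
by rewrite !hornerE /=; ring.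
Qed.

(* Let M(T, l, U) be the minimal polynomial of u + l v. Differentiating
   M(f, l, u + l v) = 0 in l expresses v rationally in u + l v; since M is
   separable, l can be specialized to a real number c. *)
Lemma eventually_primitive_element u v :
  eventually_algebraic u -> eventually_algebraic v ->
  exists c : R, let theta := fun e => u e + c * v e in
  [/\ eventually_algebraic theta, eventually_generates theta u
    & eventually_generates theta v].
Proof.
move=> algu algv; have lexPF := lex_filter_proper.
have pchar0 k : k.+1%:R != 0 :> R1.
  by rewrite -!(rmorph_nat (@polyC _)) !polyC_eq0 pnatr_eq0.
have [M [M0 rM sepM _]] := eventual_minpoly lexPF (phi := lex_morph)
  pchar0 (lex_combination_algebraic algu algv).
have [a [b [D [D0 bez]]]] := separable_poly_bezout sepM.
have [[e0 c] Dc] := @filter_ex _ _ lexPF _ (near_lex_eval_neq0 D0).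
have {e0}Dc : D.[c%:P] != 0.
  by apply: contraNneq Dc; rewrite lex_evalE /= => ->; rewrite horner0.
pose sp := map_poly (horner_eval c%:P) : {poly R1} -> {poly {poly R}}.
have spE Q e y : (map_poly (lex_morph (e, c)) Q).[y] = (sp Q).[y, f e].
  by rewrite -map_poly_horner_evalE /sp -map_poly_comp.
pose Ev Q e l := (map_poly (lex_morph (e, l)) Q).[u e + l * v e].
have EvM Q Q' e l : Ev (Q * Q') e l = Ev Q e l * Ev Q' e l.
  by rewrite /Ev rmorphM hornerM.
have EvD Q Q' e l : Ev (Q + Q') e l = Ev Q e l + Ev Q' e l.
  by rewrite /Ev rmorphD hornerD.
have EvC d e l : Ev d%:P e l = d.[l%:P].[f e] by rewrite /Ev map_polyC hornerC.
(* For a fixed e the value of M is a polynomial in l that vanishes for all large l, hence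
   identically. Its derivative in l vanishes too, and both identities may be used at the particular
   value c. *)
have rM' : \forall e \near F, forall l, Ev M e l = 0 /\
    Ev (map_poly (@deriv _) M) e l + v e * Ev M^`() e l = 0.
  rewrite /eventual_root in rM; apply: (@filterS _ F _ _ _ _ rM) => e /= rMe.
  pose W : R1 := (u e)%:P%:P + (v e)%:P%:P * 'X.
  pose S Q := map_poly (horner_eval (f e)) Q.[W].
  have SE Q l : (S Q).[l] = Ev Q e l.
    rewrite /S map_poly_horner_evalE /Ev.
    rewrite (@horner_map_polyE _ _ (lex_morph (e, l)) (fun y => y%:P%:P)); last first.
      by rewrite /= lex_evalE !hornerC.
    rewrite /= lex_evalE /=.
    have hW : W.[l%:P] = (u e + l * v e)%:P.
      by rewrite /W !hornerE /= polyCD polyCM mulrC.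
    by congr (_.[_]); rewrite !horner_horner hW hornerC.
  have SM0 : S M = 0.
    by apply: poly_near_pinfty_eq0; apply: filterS rMe => l; rewrite SE.
  move=> l; split; first by rewrite -SE SM0 horner0.
  have := congr1 (fun p => p^`().[l]) SM0; rewrite deriv0 horner0 => <-.
  rewrite /S deriv_map deriv_horner_polyC rmorphD rmorphM /= hornerD hornerM.
  rewrite -!SE /S; congr (_ + _ * _).
  rewrite /W derivD derivC add0r derivM derivC mul0r add0r derivX mulr1.
  by rewrite map_polyC hornerC /= /horner_eval hornerC.
(* At a root of M the Bezout identity reads b M' = D. With (derivative of M in l) + v M' = 0 this
   gives D v = - b (derivative of M in l). *)
have gen_v : eventually_generates (fun e => u e + c * v e) v.
  exists D.[c%:P], (- sp (b * map_poly (@deriv _) M)); split=> //.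
  apply: (@filterS _ F _ _ _ _ rM') => e /(_ c)[Me dMe].
  have := congr1 (fun Q => Ev Q e c) bez; rewrite EvD !EvM EvC Me mulr0 add0r => <-.
  rewrite !hornerN -spE -/(Ev _ e c) EvM -mulrN; move/eqP: dMe.
  by rewrite addrC addr_eq0 => /eqP <-; ring.
exists c; split=> //.
- exists (sp M).
    (* Were M to vanish identically at l = c, the Bezout identity would give D(c) = 0. *)
    apply: contraNneq Dc => spM0.
    have := congr1 sp bez; rewrite /sp rmorphD !rmorphM /= map_polyC.
    rewrite -deriv_map -/(sp M) spM0 deriv0 !mulr0 addr0 => /esym/eqP.
    by rewrite polyC_eq0.
  by apply: (@filterS _ F _ _ _ _ rM') => e /(_ c)[Me _]; rewrite -spE.
- have [d [q [d0 dv]]] := gen_v.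
  exists d, (d *: 'X - c%:P *: q); split=> //.
  apply: (@filterS _ F _ _ _ _ dv) => e dve.
  by rewrite !hornerE -dve; ring.
Qed.

End PrimitiveElement.

Section PrimitiveElementFamily.
Variables (R : realType) (E : pointedType) (F : set_system E) (FF : ProperFilter F).
Variable f : E -> R.
Hypothesis f_pinfty : f @ F --> +oo.
Local Notation eventually_generates := (eventually_generates F f).
Local Notation eventually_algebraic := (eventually_algebraic F f).

Lemma eventually_generates_poly theta (g : {poly R}) :
  eventually_generates theta (fun e => g.[f e]).
Proof.
exists 1, g%:P; split; first exact: oner_neq0.
by apply: nearW => e; rewrite !hornerE.
Qed.

Lemma eventually_generatesD theta u v : eventually_generates theta u ->
  eventually_generates theta v -> eventually_generates theta (fun e => u e + v e).
Proof.
move=> [d [q [d0 hu]]] [d' [q' [d'0 hv]]].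
exists (d * d'), (d' *: q + d *: q'); split; first exact: mulf_neq0.
by apply: filterS2 hu hv => e hu hv; rewrite !hornerE -hu -hv; ring.
Qed.

Lemma eventually_generatesM theta u v : eventually_generates theta u ->
  eventually_generates theta v -> eventually_generates theta (fun e => u e * v e).
Proof.
move=> [d [q [d0 hu]]] [d' [q' [d'0 hv]]].
exists (d * d'), (q * q'); split; first exact: mulf_neq0.
by apply: filterS2 hu hv => e hu hv; rewrite !hornerM -hu -hv mulrACA.
Qed.

Lemma eventually_generates_trans h theta g : eventually_generates theta h ->
  eventually_generates h g -> eventually_generates theta g.
Proof.
move=> th [d [q [d0 hg]]].
have [d' [q' [d'0 hq]]] : eventually_generates theta (fun e => q.[h e, f e]).
  elim/poly_ind: q {hg} => [|q c IH].
    have := eventually_generates_poly theta 0.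
    by congr (eventually_generates _ _); apply/funext => e; rewrite !horner0.
  have := eventually_generatesD (eventually_generatesM IH th)
            (eventually_generates_poly theta c).
  by congr (eventually_generates _ _); apply/funext => e; rewrite !hornerE.
exists (d' * d), q'; split; first exact: mulf_neq0.
by apply: filterS2 hg hq => e hg hq; rewrite hornerM -mulrA hg.
Qed.

(** The generator is a linear form in the x i. When these are the coordinates, it is a polynomial
    function on the whole space, so its value at points not known to lie on X still makes sense. *)
Lemma eventually_primitive_family n (x : 'I_n -> E -> R) :
  (forall i, eventually_algebraic (x i)) ->
  exists c : 'I_n -> R, let h := fun e => \sum_i c i * x i e in
  eventually_algebraic h /\ forall i, eventually_generates h (x i).
Proof.
move=> algx.
suff H (s : seq 'I_n) : exists c : 'I_n -> R, let h := fun e => \sum_i c i * x i e in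
    eventually_algebraic h /\ forall i, i \in s -> eventually_generates h (x i).
  have [c [algh genh]] := H (enum 'I_n).
  by exists c; split=> // i; apply: genh; rewrite mem_enum.
elim: s => [|j s [c [algh genh]]].
  exists (fun=> 0); split=> //; exists 'X; first by rewrite polyX_eq0.
  by apply: nearW => e; rewrite big1 ?hornerX ?hornerC // => i _; rewrite mul0r.
have [a [alga genah genaj]] := eventually_primitive_element FF f_pinfty algh (algx j).
exists (fun i => c i + a * (i == j)%:R).
have -> : (fun e => \sum_i (c i + a * (i == j)%:R) * x i e) =
          (fun e => \sum_i c i * x i e + a * x j e).
  apply/funext => e; under eq_bigr do rewrite mulrDl; rewrite big_split /=.
  congr (_ + _); rewrite (bigD1 j) //= eqxx mulr1 big1 ?addr0 // => i /negPf->.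
  by rewrite mulr0 mul0r.
split=> // i; rewrite in_cons => /orP[/eqP->//|/genh].
exact: eventually_generates_trans.
Qed.

End PrimitiveElementFamily.

Section MpolyFunctions.
Variables (R : comNzRingType) (n : nat).

Lemma meval_ind (Pr : (('I_n -> R) -> R) -> Prop) :
  (forall c, Pr (fun=> c)) -> (forall i, Pr (fun v => v i)) ->
  (forall F G, Pr F -> Pr G -> Pr (fun v => F v + G v)) ->
  (forall F G, Pr F -> Pr G -> Pr (fun v => F v * G v)) ->
  forall p : mpoly.mpoly n R, Pr (fun v => mpoly.meval v p).
Proof.
move=> Pc Pi PD PM; have Pprod I (r : seq I) (G : I -> ('I_n -> R) -> R) :
    (forall i, Pr (G i)) -> Pr (fun v => \prod_(i <- r) G i v).
  move=> PG; elim: r => [|i r IH].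
    by have := Pc 1; congr Pr; apply/funext => v; rewrite big_nil.
  by have := PM _ _ (PG i) IH; congr Pr; apply/funext => v; rewrite big_cons.
elim/mpoly.mpolyind => [|c m p _ _ IH].
  by have := Pc 0; congr Pr; apply/funext => v; rewrite mpoly.meval0.
have := PD _ _ (PM _ _ (Pc c) (Pprod _ (index_enum 'I_n) (fun i v => v i ^+ m i) _)) IH.
have H : (forall i, Pr (fun v => v i ^+ m i)).
  move=> i; elim: (m i) => [|k IHk].
    by have := Pc 1; congr Pr; apply/funext => v; rewrite expr0.
  by have := PM _ _ (Pi i) IHk; congr Pr; apply/funext => v; rewrite exprS.
move=> /(_ H); congr Pr; apply/funext => v.
by rewrite mpoly.mevalD mpoly.mevalZ mpoly.mevalX.
Qed.

End MpolyFunctions.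

(** * The curve at infinity as a family of real roots *)

Section CurveAtInfinity.
Variables (R : realType) (n : nat).

Definition sqnorm (x : 'rV[R]_n) : R := \sum_i x 0 i ^+ 2.

Definition at_infinity (X : set 'rV[R]_n) : set_system 'rV[R]_n :=
  [set A | exists r, forall x, X x -> r < sqnorm x -> A x].

Lemma at_infinity_proper X : (forall r, exists2 x, X x & r < sqnorm x) ->
  ProperFilter (at_infinity X).
Proof.
move=> unbX; split; last split.
- by move=> [r hr]; have [x Xx rx] := unbX r; exact: hr rx.
- by exists 0.
- move=> A B [r hA] [s hB]; exists (Num.max r s) => x Xx.
  by rewrite gt_max => /andP[rx sx]; split; [exact: hA | exact: hB].
- by move=> A B AB [r hA]; exists r => x Xx rx; apply/AB/hA.
Qed.

Lemma sqnorm_at_infinity X : sqnorm @ at_infinity X --> +oo.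
Proof. by move=> A [r [_ hr]]; exists r => x _ rx; exact: hr. Qed.

Section Model.
Variables (f h : 'rV[R]_n -> R) (F : set_system 'rV[R]_n) (FF : ProperFilter F).
Hypothesis f_pinfty : f @ F --> +oo.
Variables (d : {poly R}) (q : 'I_n -> {poly {poly R}}) (P : {poly {poly R}}).
Hypothesis d0 : d != 0.
Hypothesis dq : \forall x \near F, forall i, d.[f x] * x 0 i = (q i).[h x, f x].
Hypothesis P_min : forall Q : {poly {poly R}},
  (\forall x \near F, Q.[h x, f x] = 0) -> exists g W, g != 0 /\ g *: Q = W * P.

Definition model_point (c y : R) : 'rV[R]_n := \row_i ((q i).[y, c] / d.[c]).

(** At v = q(y, c) / d(c), the quantity Phi is a polynomial in c and y divided by a power of d(c).
    The condition on v is multiplicative so that it covers the points of X near infinity as well as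
    the model points. *)
Definition model_rational (Phi : R -> R -> ('I_n -> R) -> R) : Prop :=
  exists k (Q : {poly {poly R}}), forall c y v, d.[c] != 0 ->
    (forall i, d.[c] * v i = (q i).[y, c]) -> Q.[y, c] = d.[c] ^+ k * Phi c y v.

Lemma model_rational_cst a : model_rational (fun _ _ _ => a).
Proof. by exists 0%N, a%:P%:P => c y v _ _; rewrite !hornerC mul1r. Qed.

Lemma model_rational_fst : model_rational (fun c _ _ => c).
Proof. by exists 0%N, 'X%:P => c y v _ _; rewrite !hornerC hornerX mul1r. Qed.

Lemma model_rational_snd : model_rational (fun _ y _ => y).
Proof. by exists 0%N, 'X => c y v _ _; rewrite hornerX hornerC mul1r. Qed.

Lemma model_rational_coord i : model_rational (fun _ _ v => v i).
Proof. by exists 1%N, (q i) => c y v _ dv; rewrite -dv. Qed.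

Lemma model_rationalD Phi Psi : model_rational Phi -> model_rational Psi ->
  model_rational (fun c y v => Phi c y v + Psi c y v).
Proof.
move=> [k [Q hQ]] [l [S hS]]; exists (k + l)%N, (d ^+ l *: Q + d ^+ k *: S).
move=> c y v dc dv; rewrite hornerD !hornerZ hornerD !hornerM !horner_exp.
by rewrite (hQ c y v) // (hS c y v) // exprD; ring.
Qed.

Lemma model_rationalM Phi Psi : model_rational Phi -> model_rational Psi ->
  model_rational (fun c y v => Phi c y v * Psi c y v).
Proof.
move=> [k [Q hQ]] [l [S hS]]; exists (k + l)%N, (Q * S).
move=> c y v dc dv; rewrite !hornerM.
by rewrite (hQ c y v) // (hS c y v) // exprD; ring.
Qed.

Lemma model_rational_meval (p : mpoly.mpoly n R) :
  model_rational (fun _ _ v => mpoly.meval v p).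
Proof.
apply: (@meval_ind R n (fun G => model_rational (fun _ _ v => G v))).
- exact: model_rational_cst.
- exact: model_rational_coord.
- by move=> G H; exact: model_rationalD.
- by move=> G H; exact: model_rationalM.
Qed.

(** Along X the numerator of Phi vanishes at (h, f), so by minimality of P it divides by P up to a
    factor g(c). It therefore vanishes at every zero of P with g(c) nonzero, whether or not this
    zero comes from a point of X. *)
Lemma model_zero Phi : model_rational Phi ->
  (\forall x \near F, Phi (f x) (h x) (x 0) = 0) ->
  exists2 g : {poly R}, g != 0 & forall c y, g.[c] != 0 -> P.[y, c] = 0 ->
    Phi c y (model_point c y 0) = 0.
Proof.
move=> [k [Q hQ]] Phi0.
have [g [W [g0 gQ]]] : exists g W, g != 0 /\ g *: Q = W * P.
  apply: P_min.
  apply: (@filterS3 _ F _ _ _ _ _ _ Phi0 dq (near_horner_neq0 f_pinfty d0)).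
  by move=> x Phix dqx dx; rewrite (hQ _ _ _ dx dqx) Phix mulr0.
exists (g * d) => [|c y]; first exact: mulf_neq0.
rewrite hornerM mulf_eq0 negb_or => /andP[gc dc] Pyc.
have := congr1 (fun S : {poly {poly R}} => S.[y, c]) gQ.
rewrite hornerZ !hornerM Pyc mulr0 => /eqP; rewrite mulf_eq0 (negPf gc) /=.
rewrite (hQ c y (model_point c y 0)) //; last first.
  by move=> i; rewrite mxE mulrC divfK.
by rewrite mulf_eq0 expf_eq0 (negPf dc) andbF => /eqP.
Qed.

End Model.
Definition sqnorm_mpoly : mpoly.mpoly n R :=
  \sum_i mpoly.mpolyX R (mpoly.mnm1 i) ^+ 2.

Lemma meval_sqnorm_mpoly (v : 'I_n -> R) :
  mpoly.meval v sqnorm_mpoly = \sum_i v i ^+ 2.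
Proof.
rewrite rmorph_sum; apply: eq_bigr => i _.
by rewrite rmorphXn /= mpoly.mevalXU.
Qed.

Lemma common_denominator m (d : 'I_m -> {poly R}) : (forall i, d i != 0) ->
  exists2 D : {poly R}, D != 0 & forall i, exists b, D = b * d i.
Proof.
move=> d0; exists (\prod_i d i); first exact/prodf_neq0.
by move=> i; exists (\prod_(j | j != i) d j); rewrite (bigD1 i) //= mulrC.
Qed.

(* The third clause is a polynomial identity modulo P, so it also holds for
   very negative c, where it shows that P(., c) has no real root. *)
Theorem curve_model_at_infinity (X : set 'rV[R]_n) :
  real_algebraic_set X ->
  (forall e P, prime_chain (vanishing_ideal X) P e -> (e <= 1)%N) ->
  (forall r, exists2 x, X x & r < sqnorm x) ->
  exists (P : {poly {poly R}}) (D : {poly R}) (h : 'rV[R]_n -> R)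
    (d : {poly R}) (q : 'I_n -> {poly {poly R}}),
  [/\ D != 0,
    forall c, D.[c] != 0 -> [/\ d.[c] != 0, (lead_coef P).[c] != 0 &
      separable_poly (map_poly (horner_eval c) P)],
    forall c y, D.[c] != 0 -> P.[y, c] = 0 ->
      [/\ X (model_point d q c y), sqnorm (model_point d q c y) = c &
          h (model_point d q c y) = y] &
    exists r, forall x, X x -> r < sqnorm x ->
      P.[h x, sqnorm x] = 0 /\ model_point d q (sqnorm x) (h x) = x].
Proof.
move=> [Fs XE] dimX unbX.
have FF := at_infinity_proper unbX; set F := at_infinity X in FF.
have f_pinfty : sqnorm @ F --> +oo := @sqnorm_at_infinity X.
have [l] : exists c : 'I_n -> R, let h := fun x : 'rV_n => \sum_i c i * x 0 i in
    eventually_algebraic F sqnorm h /\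
    forall i, eventually_generates F sqnorm h (fun x => x 0 i).
  apply: (@eventually_primitive_family R _ F FF sqnorm f_pinfty n (fun i x => x 0 i)).
  move=> i; have [Q Q0 hQ] := krull_dim1_algebraic_dependence sqnorm_mpoly
    (mpoly.mpolyX R (mpoly.mnm1 i)) dimX.
  exists Q => //; exists 0 => x Xx _; have := hQ x Xx.
  by rewrite mpoly.mevalXU meval_sqnorm_mpoly.
set h := fun x => _ => -[algh genh].
pose ev (x : 'rV[R]_n) : {rmorphism {poly R} -> R} := horner_eval (sqnorm x).
have evE x Q y : (map_poly (ev x) Q).[y] = Q.[y, sqnorm x].
  exact: map_poly_horner_evalE.
have pchar0 k : k.+1%:R != 0 :> {poly R}.
  by rewrite -(rmorph_nat (@polyC _)) polyC_eq0 pnatr_eq0.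
have [P [P0 rP sepP Pmin]] : exists M, [/\ M != 0, eventual_root F ev h M,
    separable_poly M & forall Q, eventual_root F ev h Q ->
      exists c W, c != 0 /\ c *: Q = W * M].
  apply: eventual_minpoly => //; have [N N0 rN] := algh; exists N => //.
  by apply: (@filterS _ F _ _ _ _ rN) => x; rewrite evE.
have {}rP : \forall x \near F, P.[h x, sqnorm x] = 0.
  by apply: (@filterS _ F _ _ _ _ rP) => x; rewrite evE.
have {}Pmin Q : (\forall x \near F, Q.[h x, sqnorm x] = 0) ->
    exists g W, g != 0 /\ g *: Q = W * P.
  move=> rQ; apply: Pmin.
  by apply: (@filterS _ F _ _ _ _ rQ) => x; rewrite evE.
have [a [b [Ds [Ds0 bez]]]] := separable_poly_bezout sepP.
have /choice[dq0 dq0P] : forall i, exists dq : {poly R} * {poly {poly R}},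
    dq.1 != 0 /\ \forall x \near F, dq.1.[sqnorm x] * x 0 i = dq.2.[h x, sqnorm x].
  by move=> i; have [d [q dqP]] := genh i; exists (d, q).
have [d d0 /choice[bd dE]] := common_denominator (fun i => (dq0P i).1).
pose q i := bd i *: (dq0 i).2.
have dq : \forall x \near F, forall i, d.[sqnorm x] * x 0 i = (q i).[h x, sqnorm x].
  apply: filter_forall => i; apply: (@filterS _ F _ _ _ _ (dq0P i).2) => x dqx.
  by rewrite (dE i) /q hornerZ !hornerM -dqx mulrA.
have zero := @model_zero sqnorm h F FF f_pinfty d q P d0 dq Pmin.
have [gX gX0 gXP] : exists2 g : {poly R}, g != 0 & forall c y, g.[c] != 0 ->
    P.[y, c] = 0 -> forall p, p \in Fs -> mpoly.meval (model_point d q c y 0) p = 0.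
  have : forall p, p \in Fs -> forall x, X x -> mpoly.meval (x 0) p = 0.
    by move=> p pF x; rewrite XE => /(_ p pF).
  elim: Fs {XE} => [|p Fs IH] FsX; first by exists 1 => //; exact: oner_neq0.
  have [p' p'F|g g0 gP] := IH; first by apply: FsX; rewrite in_cons p'F orbT.
  have [||g' g'0 g'P] := zero (fun _ _ v => mpoly.meval v p).
  - exact: model_rational_meval.
  - by exists 0 => x Xx _; apply: FsX => //; exact: mem_head.
  exists (g * g') => [|c y]; first exact: mulf_neq0.
  rewrite hornerM mulf_eq0 negb_or => /andP[gc g'c] Pyc p1.
  by rewrite in_cons => /orP[/eqP->|]; [exact: g'P | exact: gP].
have [||gn gn0 gnP] := zero (fun c _ v => mpoly.meval v sqnorm_mpoly + -1 * c).
- apply: model_rationalD; first exact: model_rational_meval.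
  by apply: model_rationalM; [exact: model_rational_cst|exact: model_rational_fst].
- by apply: nearW => x; rewrite meval_sqnorm_mpoly mulN1r subrr.
pose hp : mpoly.mpoly n R := \sum_i mpoly.mpolyC n (l i) * mpoly.mpolyX R (mpoly.mnm1 i).
have hpE (v : 'I_n -> R) : mpoly.meval v hp = \sum_i l i * v i.
  rewrite rmorph_sum; apply: eq_bigr => i _.
  by rewrite rmorphM /= mpoly.mevalC mpoly.mevalXU.
have [||gh gh0 ghP] := zero (fun _ y v => mpoly.meval v hp + -1 * y).
- apply: model_rationalD; first exact: model_rational_meval.
  by apply: model_rationalM; [exact: model_rational_cst|exact: model_rational_snd].
- by apply: nearW => x; rewrite hpE mulN1r subrr.
(* The bad values of c: the poles of the model ([d]), the exceptions for the equations of X, for the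
   norm and for h ([gX], [gn], [gh]), the fibers that may fail to be separable ([Ds]), and those
   where the degree drops. *)
exists P, (d * gX * gn * gh * Ds * lead_coef P), h, d, q; split.
- by rewrite !mulf_neq0 ?lead_coef_eq0.
- move=> c; rewrite !hornerM !mulf_eq0 !negb_or -!andbA.
  move=> /and5P[dc _ _ _ /andP[Dc Pc]]; split=> //.
  rewrite unlock; apply/Bezout_coprimepP.
  pose sp := map_poly (horner_eval c) : {poly {poly R}} -> {poly R}.
  exists (sp a, sp b); rewrite -size_poly_eq1 deriv_map.
  rewrite -[sp a * _]/(sp a * sp P) -[sp b * _]/(sp b * sp P^`()).
  have := congr1 sp bez; rewrite /sp rmorphD !rmorphM /= => ->.
  by rewrite map_polyC size_polyC Dc.
- move=> c y; rewrite !hornerM !mulf_eq0 !negb_or -!andbA.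
  move=> /and5P[dc gXc gnc ghc _] Pyc; split.
  + by rewrite XE => p; exact: gXP.
  + have /eqP := gnP c y gnc Pyc.
    by rewrite mulN1r subr_eq0 meval_sqnorm_mpoly => /eqP.
  + by have /eqP := ghP c y ghc Pyc; rewrite mulN1r subr_eq0 hpE => /eqP.
- have [r hr] : F [set x | [/\ P.[h x, sqnorm x] = 0, d.[sqnorm x] != 0 &
      forall i, d.[sqnorm x] * x 0 i = (q i).[h x, sqnorm x]]].
    exact: (@filterS3 _ F _ _ _ _ _ (fun x a b c => And3 a b c) rP
      (near_horner_neq0 f_pinfty d0) dq).
  exists r => x Xx rx; have [Px dx dqx] := hr x Xx rx; split=> //.
  by apply/rowP => i; rewrite mxE -dqx mulrC mulKf.
Qed.

End CurveAtInfinity.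

(** The cofactor of the linear factors has no real root, since such a root would be a double root of
    p. A polynomial of odd degree has a real root, so the cofactor has even degree, that is, odd
    size. *)
Lemma separable_roots_parity (R : rcfType) (p : {poly R}) (s : seq R) :
  separable_poly p -> uniq s -> (forall x, root p x = (x \in s)) ->
  odd (size s) = ~~ odd (size p).
Proof.
move=> sepp us sE; have p0 := separable_poly_neq0 sepp.
have [||q pE] := @uniq_roots_prod_XsubC _ p s.
- by apply/allP => x; rewrite sE.
- by rewrite uniq_rootsE.
have q0 : q != 0 by apply: contraNneq p0 => q0; rewrite pE q0 mul0r.
have oq : odd (size q).
  apply/negPn/negP => /odd_poly_root[x qx].
  have : x \in s by rewrite -sE pE rootM qx.
  rewrite -root_prod_XsubC => sx.
  have := @separable_coprime _ p q (\prod_(z <- s) ('X - z%:P)) sepp.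
  rewrite {1}pE dvdpp => /(_ isT) /coprimep_root /(_ qx).
  by rewrite -rootE sx.
rewrite pE size_mul ?(monic_neq0 (monic_prod_XsubC _ _ _)) // (size_prod_XsubC s id) addnS /=.
by rewrite oddD oq; case: odd.
Qed.

(** * Continuity of the real roots of a separable polynomial in its coefficients *)

Section HornerContinuity.
Variable R : realType.

Lemma cvg_horner (T : Type) (F : set_system T) (FF : Filter F) (p : {poly R})
  (u : T -> R) (a : R) : u @ F --> a -> p.[u x] @[x --> F] --> p.[a].
Proof. by move=> ua; apply: cvg_comp ua _; exact: continuous_horner. Qed.

Lemma cvg_horner2 (T : Type) (F : set_system T) (FF : Filter F)
    (P : {poly {poly R}}) (u v : T -> R) (a b : R) :
  u @ F --> a -> v @ F --> b -> P.[v x, u x] @[x --> F] --> P.[b, a].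
Proof.
move=> ua vb; elim/poly_ind: P => [|P c IH].
  by rewrite !horner0; under eq_fun do rewrite !horner0; exact: cvg_cst.
under eq_fun do rewrite hornerMXaddC hornerD hornerM hornerC.
rewrite hornerMXaddC hornerD hornerM hornerC.
by apply: cvgD; [exact: cvgM | exact: cvg_horner].
Qed.

End HornerContinuity.

Section RootContinuity.
Variables (R : realType) (P : {poly {poly R}}).
Local Notation fiber c := (map_poly (horner_eval c) P).

Lemma root_fiber c y : root (fiber c) y = (P.[y, c] == 0).
Proof. by rewrite rootE map_poly_horner_evalE. Qed.

Lemma lead_coef_fiber c : (lead_coef P).[c] != 0 ->
  lead_coef (fiber c) = (lead_coef P).[c].
Proof. by move=> Pc; rewrite lead_coef_map_eq. Qed.

Lemma size_fiber c : (lead_coef P).[c] != 0 -> size (fiber c) = size P.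
Proof. by move=> Pc; rewrite size_map_poly_id0. Qed.

Lemma fiber_neq0 c : (lead_coef P).[c] != 0 -> fiber c != 0.
Proof. by move=> Pc; rewrite -lead_coef_eq0 lead_coef_fiber. Qed.

Lemma near_lead_coef_neq0 c0 : (lead_coef P).[c0] != 0 ->
  \forall c \near c0, (lead_coef P).[c] != 0.
Proof.
move=> Pc0; have : (lead_coef P).[c] @[c --> c0] --> (lead_coef P).[c0].
  by apply: cvg_horner; exact: cvg_id.
by move/cvgr_neq0; apply.
Qed.

(** The Cauchy bound of the fiber depends continuously on c as long as the leading coefficient does
    not vanish. *)
Lemma near_roots_bounded c0 : (lead_coef P).[c0] != 0 ->
  exists B, \forall c \near c0, forall y, P.[y, c] = 0 -> `|y| <= B.
Proof.
move=> Pc0.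
pose b c := 1 + `|(lead_coef P).[c]|^-1 * \sum_(i < size P) `|(P`_i).[c]|.
have bc0 : b c @[c --> c0] --> b c0.
  apply: cvgD; first exact: cvg_cst.
  apply: cvgM.
    apply: cvgV; first by rewrite normr_eq0.
    by apply: cvg_norm; apply: cvg_horner; exact: cvg_id.
  apply: cvg_big => [|i _]; first exact: add_continuous.
  by apply: cvg_norm; apply: cvg_horner; exact: cvg_id.
exists (b c0 + 1); near=> c => y Pyc.
have Pc : (lead_coef P).[c] != 0 by near: c; exact: near_lead_coef_neq0.
have : `|y| < cauchy_bound (fiber c).
  by apply: cauchy_boundP; [exact: fiber_neq0 | rewrite map_poly_horner_evalE].
move/ltW/le_trans; apply.
rewrite /cauchy_bound lead_coef_fiber // size_fiber //.
have -> : \sum_(i < size P) `|(fiber c)`_i| = \sum_(i < size P) `|(P`_i).[c]|.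
  by apply: eq_bigr => i _; rewrite coef_map.
rewrite -/(b c); apply/ltW; near: c; apply: cvgr_lt bc0 _ _.
by rewrite ltrDl.
Unshelve. all: by end_near. Qed.

End RootContinuity.

Section RootPerturbation.
Variables (R : realType) (P : {poly {poly R}}).
Local Notation fiber c := (map_poly (horner_eval c) P).

Lemma near_horner2 (Q : {poly {poly R}}) (a b : R) (A : set R) : open A ->
  A Q.[b, a] -> \forall z \near (a, b), A Q.[z.2, z.1].
Proof.
move=> oA Ab; have : Q.[z.2, z.1] @[z --> (a, b)] --> Q.[b, a].
  by apply: cvg_horner2; [exact: cvg_fst | exact: cvg_snd].
by apply; exact: open_nbhs_nbhs.
Qed.

Lemma near_horner2_neq0 (Q : {poly {poly R}}) (a b : R) : Q.[b, a] != 0 ->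
  exists2 e, 0 < e & forall c y, `|c - a| < e -> `|y - b| < e -> Q.[y, c] != 0.
Proof.
move=> Qn; have oneq : open [set x : R | x != 0].
  by rewrite (_ : [set x | _] = ~` [set 0]) ?openC //; apply/seteqP; split => x /eqP.
have /nbhs_ballP[e e0 He] := near_horner2 oneq Qn.
exists e => // c y ca yb; apply: (He (c, y)).
by split; rewrite /= /ball /= distrC.
Qed.

Section AtPoint.
Variable c0 : R.
Hypothesis lc0 : (lead_coef P).[c0] != 0.
Hypothesis sep0 : separable_poly (fiber c0).
Local Notation r := (rootsR (fiber c0)).
Local Notation N := (size r).

Lemma mem_rootsR_fiber c y : (lead_coef P).[c] != 0 ->
  (y \in rootsR (fiber c)) = (P.[y, c] == 0).
Proof.
by move=> Pc; rewrite -roots_on_rootsR ?fiber_neq0 // root_fiber.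
Qed.

Lemma simple_root (j : 'I_N) : P^`().[r`_j, c0] != 0.
Proof.
rewrite -map_poly_horner_evalE -deriv_map.
move: sep0; rewrite unlock => /coprimep_root; apply.
by rewrite root_fiber -mem_rootsR_fiber // mem_nth.
Qed.

(** The intervals of radius delta around the roots are disjoint, and each will hold at most one root
    of a nearby fiber, the derivative having no zero there. *)
Lemma root_isolation (e : R) : 0 < e -> exists2 delta : R, 0 < delta < e &
  (forall i j : 'I_N, (i < j)%N -> r`_i + delta < r`_j - delta) /\
  forall j : 'I_N, exists2 e', 0 < e' & forall c y, `|c - c0| < e' ->
     `|y - r`_j| <= delta -> P^`().[y, c] != 0.
Proof.
move=> e0.
have /filter_ex [d [[d0 de] dsep dder]] : \forall d \near 0^'+,
   [/\ 0 < d /\ d < e, forall i : 'I_N, forall j : 'I_N, (i < j)%N -> r`_i + d < r`_j - d &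
   forall j : 'I_N, exists2 e', 0 < e' & forall c y, `|c - c0| < e' ->
     `|y - r`_j| <= d -> P^`().[y, c] != 0].
  near=> d; split.
  - by split; near: d; [exact: nbhs_right_gt | exact: nbhs_right_lt].
  - near: d; apply: filter_forall => i; apply: filter_forall => j.
    have [ij|] := ltnP i j; last by move=> _; apply: nearW => d.
    have rij : r`_i < r`_j.
      apply: (sorted_ltn_nth lt_trans) => //; first exact: sorted_roots.
      by rewrite inE. by rewrite inE.
    near=> d => _; rewrite ltrBrDr -addrA -ltrBrDl -mulr2n -mulr_natr.
    rewrite -ltr_pdivlMr //; near: d; apply: nbhs_right_lt.
    by rewrite divr_gt0 // subr_gt0.
  - near: d; apply: filter_forall => j.
    have [e' e'0 He'] := near_horner2_neq0 (simple_root j).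
    near=> d; exists e' => // c y cc yr; apply: He' => //.
    by apply: le_lt_trans yr _; near: d; exact: nbhs_right_lt.
by exists d; rewrite ?d0.
Unshelve. all: by end_near. Qed.

(** By the mean value theorem on either side of the root, the two values are - P'(x1) delta and
    P'(x2) delta; P' keeps its sign between x1 and x2, having no zero there. *)
Lemma sign_change (j : 'I_N) (delta : R) : 0 < delta ->
  (forall y, `|y - r`_j| <= delta -> P^`().[y, c0] != 0) ->
  P.[r`_j - delta, c0] * P.[r`_j + delta, c0] < 0.
Proof.
move=> d0 hd.
have rj0 : (fiber c0).[r`_j] = 0.
  by apply/eqP; rewrite -rootE root_fiber -mem_rootsR_fiber // mem_nth.
rewrite -!map_poly_horner_evalE.
have [x1 x1i E1] : {c : R | c \in `]r`_j - delta, r`_j[ & (fiber c0).[r`_j] - (fiber c0).[r`_j - delta]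
   = (fiber c0)^`().[c] * (r`_j - (r`_j - delta))}.
  by apply: poly_mvt; rewrite ltrBlDr ltrDl.
have [x2 x2i E2] : {c : R | c \in `]r`_j, r`_j + delta[ & (fiber c0).[r`_j + delta] - (fiber c0).[r`_j]
   = (fiber c0)^`().[c] * (r`_j + delta - r`_j)}.
  by apply: poly_mvt; rewrite ltrDl.
have {}E1 : (fiber c0).[r`_j - delta] = - ((fiber c0)^`().[x1] * delta).
  by move: E1; rewrite rj0 sub0r => /(canRL (@opprK _)) ->; congr (- (_ * _)); ring.
have {}E2 : (fiber c0).[r`_j + delta] = (fiber c0)^`().[x2] * delta.
  by move: E2; rewrite rj0 subr0 => ->; congr (_ * _); ring.
rewrite E1 E2.
rewrite (_ : _ * _ = - ((fiber c0)^`().[x1] * (fiber c0)^`().[x2] * (delta * delta))); last by ring.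
rewrite oppr_lt0 pmulr_lgt0; last exact: mulr_gt0.
have x12 : x1 <= x2.
  move: x1i x2i; rewrite !in_itv /= => /andP[_ x1r] /andP[rx2 _].
  by apply/ltW/(lt_trans x1r).
rewrite ltNge; apply/negP => pp; have [y yi] := polyrcf.poly_ivt x12 pp.
rewrite deriv_map rootE map_poly_horner_evalE; apply/negP/hd.
move: x1i x2i yi; rewrite !in_itv /= => /andP[x1r _] /andP[_ rx2] /andP[x1y yx2].
by rewrite ler_distl; apply/andP; split; lra.
Qed.

(** In each isolating interval the sign change persists and yields a root, and Rolle's theorem
    forbids a second one. Outside these intervals there is none, by the bound on the roots and
    compactness. *)
Lemma roots_perturbation (e : R) : 0 < e -> \forall c \near c0,
  size (rootsR (fiber c)) = N /\
  forall j : 'I_N, `|(rootsR (fiber c))`_j - r`_j| < e.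
Proof.
move=> e0; have [d /andP[d0 de] [dsep dder]] := root_isolation e0.
have [B HB] := near_roots_bounded lc0.
have Hcov : \forall c \near c0, forall y, `|y| <= B -> P.[y, c] = 0 ->
    exists j : 'I_N, `|y - r`_j| < d.
  have cK : compact `[- B, B]%classic by exact: segment_compact.
  pose near_root c y := P.[y, c] = 0 -> exists j : 'I_N, `|y - r`_j| < d.
  move/compact_near_coveringP: cK => /(_ R (nbhs c0) near_root _) cov.
  suff : \near c0, `[- B, B]%classic `<=` near_root c0.
    apply: filterS => c hc y yB; apply: hc.
    by rewrite /= in_itv /= -ler_norml.
  apply: cov => y yB.
  have [Py0|Py0] := eqVneq P.[y, c0] 0.
    have /(nthP 0)[k kN ky] : y \in r by rewrite mem_rootsR_fiber // Py0.
    exists (ball y d, setT) => [|[y' c] [/= yd _] _].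
      by split; [exact: nbhsx_ballx | exact: filterT].
    by exists (Ordinal kN); rewrite /= ky distrC.
  have [e' e'0 He'] := near_horner2_neq0 Py0.
  exists (ball y e', ball c0 e') => [|[y' c] [/= yd cd] P0].
    by split; exact: nbhsx_ballx.
  have := He' c y'; rewrite P0 eqxx distrC => /(_ cd).
  by rewrite distrC => /(_ yd).
have Hsign : \forall c \near c0, forall j : 'I_N,
    P.[r`_j - d, c] * P.[r`_j + d, c] < 0.
  apply: (@filter_forall R 'I_N _ (nbhs c0)) => j.
  have [e' e'0 He'] := dder j.
  have : P.[r`_j - d, c] * P.[r`_j + d, c] @[c --> c0] -->
      P.[r`_j - d, c0] * P.[r`_j + d, c0].
    by apply: cvgM; apply: cvg_horner2; (try exact: cvg_id); exact: cvg_cst.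
  move/cvgr_lt; apply; apply: sign_change => // y yd; apply: He' => //.
  by rewrite subrr normr0.
have Hder : \forall c \near c0, forall (j : 'I_N) y, `|y - r`_j| <= d ->
    P^`().[y, c] != 0.
  apply: (@filter_forall R 'I_N _ (nbhs c0)) => j; have [e' e'0 He'] := dder j.
  near=> c => y; apply: He'; near: c.
  by near do rewrite distrC; exact: nbhsx_ballx.
near=> c.
have Pc : (lead_coef P).[c] != 0 by near: c; exact: near_lead_coef_neq0.
have /choice[t tP] : forall j : 'I_N, exists t, `|t - r`_j| < d /\ P.[t, c] = 0.
  move=> j; have hs : P.[r`_j - d, c] * P.[r`_j + d, c] < 0.
    by move: j; near: c.
  rewrite -!map_poly_horner_evalE in hs.
  have [|t ti] := poly_ivtoo _ hs; first by lra.
  rewrite root_fiber => /eqP Pt; exists t; split=> //.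
  by move: ti; rewrite in_itv /= ltr_distl.
(* The new roots, listed by the old ones they approach, are increasing because the intervals are
   disjoint; so the j-th root stays close to the j-th root. *)
have tE : rootsR (fiber c) = [seq t j | j <- enum 'I_N].
  apply: lt_sorted_eq; first exact: sorted_roots.
    rewrite sorted_map; apply: (@sub_sorted _ (relpre val ltn)).
      move=> i j /= /dsep; have := (tP i).1; have := (tP j).1.
      by rewrite !ltr_distl; lra.
    by rewrite -sorted_map val_enum_ord iota_ltn_sorted.
  move=> y; rewrite mem_rootsR_fiber //; apply/eqP/mapP => [Py|[j _ ->]]; last first.
    by case: (tP j).
  have yB : `|y| <= B by move: (y) Py; near: c.
  have [j yj] : exists j : 'I_N, `|y - r`_j| < d by move: (y) yB Py; near: c.
  exists j; first by rewrite mem_enum.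
  have hder x : `|x - r`_j| <= d -> P^`().[x, c] != 0.
    by move: (j) (x); near: c.
  have [tj Ptj] := tP j.
  have uni a b : a < b -> `|a - r`_j| < d -> `|b - r`_j| < d ->
      P.[a, c] = 0 -> P.[b, c] = 0 -> False.
    move=> ab aj bj Pa Pb.
    have [|x xi] := @poly_rolle _ a b (fiber c) ab.
      by rewrite !map_poly_horner_evalE Pa Pb.
    rewrite deriv_map map_poly_horner_evalE => /eqP; apply/negP/hder.
    move: xi aj bj; rewrite in_itv /= !ltr_distl => /andP[ax xb].
    by move=> /andP[? ?] /andP[? ?]; rewrite ler_distl; apply/andP; split; lra.
  have [yt|ty|//] := ltgtP y (t j).
    by exfalso; exact: (uni y (t j)).
  by exfalso; exact: (uni (t j) y).
split=> [|j]; first by rewrite tE size_map size_enum_ord.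
rewrite tE (nth_map j) ?size_enum_ord // nth_ord_enum.
by have [tj _] := tP j; apply: lt_trans de.
Unshelve. all: by end_near. Qed.

End AtPoint.
End RootPerturbation.

(** * Ends and germs at infinity *)

(** The fiber of g through x and its complement are both traces of open sets on A. The target is a
    bare type so that [Prop] can be used, which turns the statement into one about membership in a
    set. *)
Lemma locally_constant_connected (T : topologicalType) (U : Type) (A : set T)
    (g : T -> U) : connected A ->
  (forall x, A x -> \forall z \near x, A z -> g z = g x) ->
  forall x z, A x -> A z -> g z = g x.
Proof.
move=> cA gA x z Ax Az.
have openP (S : set U) :
    A `&` [set w | S (g w)] = A `&` ([set w | A w -> S (g w)])^°.
  apply/seteqP; split=> w [Aw Sw]; split=> //=; last exact: interior_subset Sw Aw.
  by apply: filterS (gA w Aw) => v hv Av; rewrite hv.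
pose B := A `&` [set w | g w = g x].
suff BA : B = A by have [] : B z by rewrite BA.
apply: cA.
- by exists x.
- exists ([set w | A w -> g w = g x])^°; first exact: open_interior.
  exact: (openP (fun u => u = g x)).
- exists (~` ([set w | A w -> g w <> g x])^°).
    by apply: open_closedC; exact: open_interior.
  apply/seteqP; split=> w.
    by move=> [Aw gw]; split=> // nw; exact: interior_subset nw Aw gw.
  move=> [Aw nw]; split=> //; apply: contrapT => gw; apply: nw.
  have : (A `&` [set w | g w <> g x]) w by [].
  by rewrite (openP (fun u => u <> g x)) => -[].
Qed.

Section RootBranches.
Variables (R : realType) (P : {poly {poly R}}) (c0 : R).
Local Notation fiber c := (map_poly (horner_eval c) P).
Hypothesis lc_fiber : forall c, c0 < c -> (lead_coef P).[c] != 0.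
Hypothesis sep_fiber : forall c, c0 < c -> separable_poly (fiber c).

Lemma size_roots_constant c c' : c0 < c -> c0 < c' ->
  size (rootsR (fiber c)) = size (rootsR (fiber c')).
Proof.
move=> cc cc'.
apply: (@locally_constant_connected R nat `]c0, +oo[%classic
   (fun c => size (rootsR (fiber c)))).
- by apply/connected_intervalP; exact: interval_is_interval.
- move=> x; rewrite /= in_itv /= andbT => c0x.
  have := roots_perturbation (lc_fiber c0x) (sep_fiber c0x) ltr01.
  by apply: filterS => z [].
- by rewrite /= in_itv /= andbT.
- by rewrite /= in_itv /= andbT.
Qed.

Lemma root_branch_continuous j c : c0 < c ->
  (fun c => (rootsR (fiber c))`_j) @ c --> (rootsR (fiber c))`_j.
Proof.
move=> c0c; apply/cvgrPdist_lt => e e0.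
have := roots_perturbation (lc_fiber c0c) (sep_fiber c0c) e0.
apply: filterS => z [sz hz].
have [jN|jN] := ltnP j (size (rootsR (fiber c))).
  by rewrite distrC; exact: (hz (Ordinal jN)).
by rewrite !nth_default ?sz // subrr normr0.
Qed.

(** Roots neither collide nor escape over c > c0, so numbering them in increasing order gives
    continuous branches on the whole half-line. *)
Lemma root_branches : exists N (y : 'I_N -> R -> R),
  [/\ forall c, c0 < c -> size (rootsR (fiber c)) = N,
      forall c t, c0 < c -> (P.[t, c] = 0 <-> exists j, t = y j c),
      forall c, c0 < c -> injective (fun j => y j c)
    & forall j c, c0 < c -> y j @ c --> y j c].
Proof.
have c01 : c0 < c0 + 1 by rewrite ltrDl.
pose N := size (rootsR (fiber (c0 + 1))).
have sN c : c0 < c -> size (rootsR (fiber c)) = N.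
  by move=> c0c; exact: size_roots_constant.
exists N, (fun j c => (rootsR (fiber c))`_j); split=> //.
- move=> c t c0c; have memE := mem_rootsR_fiber t (lc_fiber c0c).
  split=> [Pt|[j ->]].
    have /(nthP 0)[j jN <-] : t \in rootsR (fiber c) by rewrite memE Pt.
    by rewrite sN // in jN; exists (Ordinal jN).
  apply/eqP; rewrite -mem_rootsR_fiber ?lc_fiber //.
  by rewrite mem_nth // sN.
- move=> c c0c i j /eqP; rewrite nth_uniq ?sN ?uniq_roots //.
  by move=> /eqP/val_inj.
- by move=> j c c0c; exact: root_branch_continuous.
Qed.

End RootBranches.

Lemma finpred_card_eq (T : finType) (A : pred T) : ([set j | A j] #= `I_#|A|)%card.
Proof.
have -> : [set j | A j] = (@enum_val T A) @` [set: 'I_#|A|].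
  apply/seteqP; split=> [j Aj|_ [i _ <-]]; last exact: (enum_valP i).
  by exists (enum_rank_in (Aj : j \in A) j) => //; rewrite enum_rankK_in.
apply: card_eq_trans (inj_card_eq _) _; last by rewrite card_eq_sym; exact: card_II.
by move=> i j _ _; exact: enum_val_inj.
Qed.

Lemma near_right0 (R : realType) (Pr : R -> Prop) :
  (\forall t \near 0^'+, Pr t) <->
  exists2 d : R, 0 < d & forall t, 0 < t -> t < d -> Pr t.
Proof.
split=> [|[d d0 Hd]].
  rewrite near_withinE => /nbhs_ballP[d /= d0 Hd]; exists d => // t t_gt0 td.
  by apply: Hd => //; rewrite /ball /= sub0r normrN gtr0_norm.
near=> t; apply: Hd; near: t; [exact: nbhs_right_gt|exact: nbhs_right_lt].
Unshelve. all: by end_near. Qed.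

(** * Germs of a finite disjoint union of arcs *)

Section ArcGerms.
Variables (R : realType) (V : normedModType R) (Y : set (V * R)) (t0 : R).
Variables (J : finType) (alpha : J -> R -> V) (lim : J -> V).
Hypothesis t0_gt0 : 0 < t0.
Hypothesis Y_gt0 : forall z, Y z -> 0 < z.2.
Hypothesis Y_arcs : forall v (t : R), 0 < t -> t < t0 ->
  (Y (v, t) <-> exists j, v = alpha j t).
Hypothesis arcs_inj : forall t : R, 0 < t -> t < t0 -> injective (fun j => alpha j t).
Hypothesis arcs_continuous : forall j (t : R), 0 < t -> t < t0 -> alpha j @ t --> alpha j t.
Hypothesis arcs_lim : forall j, alpha j t @[t --> 0^'+] --> lim j.

Lemma arc_in_Y j (t : R) : 0 < t -> t < t0 -> Y (alpha j t, t).
Proof. by move=> t_gt0 tt0; apply/Y_arcs => //; exists j. Qed.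

Lemma near_arc_in_ball j (e : R) : 0 < e ->
  exists2 d, 0 < d & forall t, 0 < t -> t < d ->
    [/\ t < t0, ball (lim j) e (alpha j t) & ball (lim j, 0 : R) e (alpha j t, t)].
Proof.
move=> e0; apply/near_right0; near=> t.
have bt : ball (lim j) e (alpha j t).
  by near: t; move/cvg_ballP : (@arcs_lim j) => /(_ _ e0); apply.
have tt0 : t < t0 by near: t; exact: nbhs_right_lt.
have te : t < e by near: t; exact: nbhs_right_lt.
have t_gt0 : 0 < t by near: t; exact: nbhs_right_gt.
split=> //; split=> //.
by rewrite /= /ball /= sub0r normrN gtr0_norm.
Unshelve. all: by end_near. Qed.

Lemma closure_arc_lim (C : set (V * R)) p j :
  (forall z, C z -> 0 < z.2 /\ z.1 = alpha j z.2) -> closure C (p, 0) -> lim j = p.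
Proof.
move=> Cj clp; apply/eqP/negPn/negP => jp.
have e0 : 0 < `|p - lim j| / 2 by rewrite divr_gt0 // normr_gt0 subr_eq0 eq_sym.
have [d d0 Hd] := near_arc_in_ball j e0.
have m0 : 0 < Num.min (`|p - lim j| / 2) d by rewrite lt_min e0.
have [[v t] [/Cj[/= t_gt0 vE]]] := clp _ (nbhsx_ballx (p, 0 : R) _ m0).
rewrite vE => -[/=]; rewrite -!ball_normE /= lt_min sub0r normrN gtr0_norm //.
rewrite lt_min => /andP[pv _] /andP[_ td].
have [_ + _] := Hd t t_gt0 td; rewrite -ball_normE /= => lv.
have := ler_distD (alpha j t) p (lim j); rewrite (distrC (alpha j t)).
by rewrite leNgt => /negP; apply; rewrite [ltRHS]splitr ltrD.
Qed.

Definition arc (e : R) j : set (V * R) :=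
  [set z | [/\ 0 < z.2, z.2 < e & z.1 = alpha j z.2]].

Lemma near_arc_eq j z : 0 < z.2 -> z.2 < t0 ->
  z.1 <> alpha j z.2 -> \forall w \near z, w.1 <> alpha j w.2.
Proof.
move=> z0 zt0 zj.
have : w.1 - alpha j w.2 @[w --> z] --> z.1 - alpha j z.2.
  apply: cvgB; first by case: (z) => a b; exact: cvg_fst.
  apply: (@cvg_comp _ _ _ snd (alpha j) _ (nbhs z.2)); last exact: arcs_continuous.
  by case: (z) => a b; exact: cvg_snd.
move=> /cvgr_neq0; rewrite subr_eq0 => /(_ (introN eqP zj)).
by apply: filterS => w; rewrite subr_eq0 => /eqP.
Qed.

(** Lying on arc j is a locally constant property on Y: a point of arc j has a neighbourhood that
    misses the finitely many other arcs, and a point off arc j has one that misses arc j. *)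
Lemma connected_in_arc (C : set (V * R)) j z :
  connected C -> (forall w, C w -> Y w /\ w.2 < t0) -> C z -> z.1 = alpha j z.2 ->
  forall w, C w -> w.1 = alpha j w.2.
Proof.
move=> cC CY Cz zj w Cw.
suff : (w.1 = alpha j w.2) = (z.1 = alpha j z.2) by move=> ->.
apply: (@locally_constant_connected _ Prop C (fun w => w.1 = alpha j w.2)) => //.
move=> {zj Cw Cz}x Cx; have [Yx xt0] := CY x Cx; have x0 := Y_gt0 Yx.
have [xj|xj] := pselect (x.1 = alpha j x.2).
  have : \forall w \near x, forall i, i != j -> w.1 <> alpha i w.2.
    apply: (@filter_forall _ J _ (nbhs x)) => i; have [->|ij] := eqVneq i j.
      by apply: nearW.
    have : x.1 <> alpha i x.2.
      by rewrite xj => /(arcs_inj x0 xt0) ji; rewrite ji eqxx in ij.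
    by move=> /(near_arc_eq x0 xt0); apply: filterS => u + _.
  apply: filterS => -[v t] hw Cvt; have [Yvt vt0] := CY _ Cvt.
  apply/propext; split=> // _ /=.
  have [i vi] := (Y_arcs v (Y_gt0 Yvt) vt0).1 Yvt.
  have [<-//|ij] := eqVneq i j.
  by have := hw i ij.
by apply: filterS (near_arc_eq x0 xt0 xj) => u uj _; apply/propext; split.
Qed.

Lemma closure_arcs p : closure Y (p, 0) <-> exists j, lim j = p.
Proof.
split=> [clp|[j <-]]; last first.
  move=> B /nbhs_ballP[e /= e0 eB]; have [d d0 Hd] := near_arc_in_ball j e0.
  have d2 : 0 < d / 2 /\ d / 2 < d.
    by rewrite divr_gt0 // ltr_pdivrMr // ltr_pMr // ltr1n.
  have [tt0 _ bt] := Hd _ d2.1 d2.2.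
  exists (alpha j (d / 2), d / 2); split; last exact: eB.
  by apply: arc_in_Y => //; case: d2.
apply: contrapT => nlim.
have /near_right0[m m0 Hm] : \forall e \near 0^'+, forall j,
    arc t0 j `&` ball (p, 0 : R) e = set0.
  apply: filter_forall => j; apply: contrapT => nempty.
  apply: nlim; exists j; apply: (@closure_arc_lim (arc t0 j)) => [z []//|].
  move=> B /nbhs_ballP[e /= e0 eB]; apply/set0P/negP => /eqP AB; apply: nempty.
  apply/near_right0; exists e => // t _ te; apply/seteqP; split=> // z [az bz].
  by rewrite -AB; split=> //; apply: eB; exact: le_ball (ltW te) _ bz.
pose e := Num.min m t0 / 2.
have M0 : 0 < Num.min m t0 by rewrite lt_min m0.
have e0 : 0 < e by rewrite divr_gt0.
have /andP[em et0] : (e < m) && (e < t0).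
  by rewrite -lt_min /e ltr_pdivrMr // ltr_pMr // ltr1n.
have [[v t] [Yvt bvt]] := clp _ (nbhsx_ballx (p, 0 : R) _ e0).
have t_gt0 : 0 < t := Y_gt0 Yvt.
have tt0 : t < t0.
  case: bvt => _ /=; rewrite -ball_normE /= sub0r normrN gtr0_norm // => te.
  exact: lt_trans et0.
have [j vj] := (Y_arcs v t_gt0 tt0).1 Yvt.
have /seteqP[sub _] := Hm e e0 em j.
by apply: (sub (v, t)).
Qed.

(** Each component stays on one arc. An arc tending to p has a tail inside the ball, contained in a
    single component, and every component on this arc that is adherent to p meets the tail. The arc
    may leave the ball and return, but its further components are not adherent to p. *)
Theorem germ_components_arcs p :
  germ_components Y (p, 0 : R) #|[pred j | lim j == p]|.
Proof.
near=> e; set W := Y `&` _.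
have e0 : 0 < e by near: e; exact: nbhs_right_gt.
have et0 : e < t0 by near: e; exact: nbhs_right_lt.
have WY w : W w -> Y w /\ w.2 < t0.
  move=> [Yw [_ /=]]; rewrite -ball_normE /= sub0r normrN gtr0_norm ?Y_gt0 // => we.
  by split=> //; exact: lt_trans et0.
have /choice[d dP] : forall j, exists d, lim j = p -> 0 < d /\
    forall t, 0 < t -> t < d -> W (alpha j t, t).
  move=> j; have [d d0 Hd] := near_arc_in_ball j e0; exists d => jp; split=> //.
  move=> t t_gt0 td; have [tt0 _] := Hd t t_gt0 td; rewrite jp => bt.
  by split=> //; exact: arc_in_Y.
pose base j := (alpha j (d j / 2), d j / 2).
pose tail j := (fun t => (alpha j t, t)) @` `]0, d j[%classic.
have tailW j : lim j = p -> tail j `<=` W.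
  by move=> jp _ [t + <-]; rewrite /= in_itv /= => /andP[? ?]; apply: (dP j jp).2.
have tail_base j : lim j = p -> tail j (base j).
  move=> /dP[dj _]; exists (d j / 2) => //=.
  by rewrite in_itv /= divr_gt0 //= ltr_pdivrMr // ltr_pMr // ltr1n.
have tail_conn j : lim j = p -> connected (tail j).
  move=> jp; apply: connected_continuous_connected.
    by apply/connected_intervalP; exact: interval_is_interval.
  apply: continuous_in_subspaceT => t; rewrite inE /= in_itv /= => /andP[t_gt0 td].
  have ac : alpha j @ t --> alpha j t.
    by apply: arcs_continuous => //; have /WY[] := (dP j jp).2 t t_gt0 td.
  exact: (cvg_pair ac (@cvg_id _ (nbhs t))).
pose comp j := connected_component W (base j).
have tail_comp j : lim j = p -> tail j `<=` comp j.
  by move=> jp; apply: connected_component_max; [exact: tail_base|exact: tailW|exact: tail_conn].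
have comp_arc j : lim j = p -> forall w, comp j w -> w.1 = alpha j w.2.
  move=> jp; apply: (@connected_in_arc (comp j) j (base j)) => //.
  - exact: component_connected.
  - by move=> w /connected_component_sub/WY.
  - by apply: connected_component_refl; apply: tailW (tail_base _ jp).
have -> : [set C | [set connected_component W y | y in W] C /\ closure C (p, 0)] =
    comp @` [set j | [pred j | lim j == p] j].
  apply/seteqP; split=> C.
    move=> [[[v t] Wvt <-] clC]; have [Yvt vt0] := WY _ Wvt.
    have [j vj] := (Y_arcs v (Y_gt0 Yvt) vt0).1 Yvt.
    have compj w : connected_component W (v, t) w -> 0 < w.2 /\ w.1 = alpha j w.2.
      move=> Cw; split.
        by apply: Y_gt0; exact: (WY w (connected_component_sub Cw)).1.
      apply: (@connected_in_arc (connected_component W (v, t)) j (v, t)) Cw => //.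
      - exact: component_connected.
      - by move=> u /connected_component_sub/WY.
      - exact: connected_component_refl.
    have jp : lim j = p by exact: closure_arc_lim compj clC.
    exists j; first by rewrite /= jp.
    have [dj _] := dP j jp.
    have [[v' t'] [Cw [_ /=]]] := clC _ (nbhsx_ballx (p, 0 : R) _ dj).
    rewrite -ball_normE /= sub0r normrN => t'd.
    have [/= t'0 v'j] := compj _ Cw.
    rewrite gtr0_norm // in t'd.
    rewrite /comp; apply: same_connected_component.
    apply: (@connected_component_trans _ W (v', t')).
      by apply: tail_comp => //; exists t'; rewrite ?v'j //= in_itv /= t'0.
    exact: connected_component_sym.
  move=> [j /= /eqP jp <-]; split.
    by exists (base j) => //; apply: tailW (tail_base _ jp).
  move=> B /nbhs_ballP[r /= r0 rB].
  have [dj _] := dP j jp; have [d' d'0 Hd'] := near_arc_in_ball j r0.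
  pose t := Num.min (d j) d' / 2.
  have m0 : 0 < Num.min (d j) d' by rewrite lt_min dj.
  have t_gt0 : 0 < t by rewrite divr_gt0.
  have /andP[td td'] : (t < d j) && (t < d').
    by rewrite -lt_min /t ltr_pdivrMr // ltr_pMr // ltr1n.
  exists (alpha j t, t); split.
    by apply: tail_comp => //; exists t => //=; rewrite in_itv /= t_gt0.
  by apply: rB; have [_ _] := Hd' t t_gt0 td'; rewrite jp.
apply: card_eq_trans (inj_card_eq _) (finpred_card_eq _).
move=> i j; rewrite !inE /= => /eqP ip /eqP jp cij.
have [t_gt0 td] : 0 < d i / 2 /\ d i / 2 < t0.
  have [di _] := dP i ip; split; first exact: divr_gt0.
  by have /tailW/WY[//|] := tail_base i ip.
apply: (arcs_inj t_gt0 td); have := comp_arc j jp (base i).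
apply; rewrite -cij; apply: connected_component_refl.
exact: tailW (tail_base _ ip).
Unshelve. all: by end_near. Qed.

End ArcGerms.

(** By compactness the arc is eventually within any distance of the finite set s, which contains its
    cluster points in K. For balls that are small enough to be disjoint, connectedness keeps the arc
    in one of them. *)
Lemma arc_limit (R : realType) (V : normedModType R) (K : set V) (s : seq V)
    (beta : R -> V) (t0 : R) : 0 < t0 -> compact K ->
  (forall t, 0 < t -> t < t0 -> beta @ t --> beta t) ->
  (forall t, 0 < t -> t < t0 -> K (beta t)) ->
  (forall v, K v -> v \notin s -> exists2 e : R, 0 < e &
     \forall t \near 0^'+, ~ ball v e (beta t)) ->
  exists2 a, a \in s & beta t @[t --> 0^'+] --> a.
Proof.
move=> t0_gt0 /compact_near_coveringP cK bcont bK nclust.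
have near_s (e : R) : 0 < e ->
    \forall t \near 0^'+, exists2 a, a \in s & ball a e (beta t).
  move=> e0.
  pose Q (t : R) v := beta t = v -> exists2 a, a \in s & ball a e v.
  have cov : \forall t \near 0^'+, K `<=` Q t.
    apply: cK => v Kv; have [vs|vs] := boolP (v \in s).
      exists (ball v e, setT) => [|[v' t] [/= bv _] _].
        by split; [exact: nbhsx_ballx | exact: filterT].
      by exists v.
    have [e' e'0 He'] := nclust v Kv vs.
    exists (ball v e', [set t | ~ ball v e' (beta t)]) => [|[v' t] [/= bv nb] tv].
      by split=> //; exact: nbhsx_ballx.
    by rewrite tv in nb.
  near=> t.
  have KQ : K `<=` Q t by near: t.
  apply: (KQ (beta t)) => //; apply: bK; near: t; first exact: nbhs_right_gt.
  exact: nbhs_right_lt.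
have [e e0 esep] : exists2 e : R, 0 < e & forall a b, a \in s -> b \in s -> a != b ->
    e + e <= `|a - b|.
  have /near_right0[d d0 Hd] : \forall e \near 0^'+, forall i j : 'I_(size s),
      s`_i != s`_j -> e + e <= `|s`_i - s`_j|.
    apply: filter_forall => i; apply: filter_forall => j.
    have [->|ij] := eqVneq s`_i s`_j; first by apply: nearW.
    near=> e => _; rewrite -mulr2n -mulr_natr -ler_pdivlMr //; near: e.
    by apply: nbhs_right_le; rewrite divr_gt0 // normr_gt0 subr_eq0.
  exists (d / 2) => [|a b /(nthP 0)[i si <-] /(nthP 0)[j sj <-]].
    by rewrite divr_gt0.
  by apply: (Hd _ _ _ (Ordinal si) (Ordinal sj)); rewrite ?divr_gt0 //
    ltr_pdivrMr // ltr_pMr // ltr1n.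
have uniq_center a b v : a \in s -> b \in s -> ball a e v -> ball b e v -> a = b.
  rewrite -!ball_normE /= => sa sb av bv; apply/eqP/negPn/negP => /(esep a b sa sb).
  rewrite leNgt => /negP; apply; apply: le_lt_trans (ler_distD v a b) _.
  by rewrite (distrC v) ltrD.
have /near_right0[d d0 Hd] : \forall t \near 0^'+,
    (exists2 a, a \in s & ball a e (beta t)) /\ t < t0.
  by apply: filterI; [exact: near_s | exact: nbhs_right_lt].
have d2 : 0 < d / 2 /\ d / 2 < d.
  by rewrite divr_gt0 // ltr_pdivrMr // ltr_pMr // ltr1n.
have [[a sa ba] _] := Hd _ d2.1 d2.2.
have ballE t : 0 < t -> t < d -> ball a e (beta t).
  move=> t_gt0 td.
  suff -> : ball a e (beta t) = ball a e (beta (d / 2)) by [].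
  apply: (@locally_constant_connected _ Prop `]0, d[%classic
    (fun t => ball a e (beta t))).
  - by apply/connected_intervalP; exact: interval_is_interval.
  - move=> x; rewrite /= in_itv /= => /andP[x0 xd].
    have [[b sb bb] xt0] := Hd x x0 xd.
    have near_b : \forall z \near x, ball b e (beta z).
      apply: bcont => //; apply: open_nbhs_nbhs; split=> //.
      exact: ball_open.
    apply: filterS near_b => z bz _; apply/propext; split=> h.
      by rewrite (uniq_center a b (beta z) sa sb h bz).
    by rewrite (uniq_center a b (beta x) sa sb h bb).
  - by rewrite /= in_itv /= d2.1 d2.2.
  - by rewrite /= in_itv /= t_gt0.
exists a => //; apply/cvg_ballP => r r0.
have m0 : 0 < Num.min r e by rewrite lt_min r0.
near=> t.
have [b sb bb] : exists2 b, b \in s & ball b (Num.min r e) (beta t).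
  by near: t; exact: near_s.
have -> : a = b.
  apply: (uniq_center a b (beta t)) => //.
    by apply: ballE; near: t; [exact: nbhs_right_gt | exact: nbhs_right_lt].
  by apply: le_ball bb; rewrite ge_min lexx orbT.
by apply: le_ball bb; rewrite ge_min lexx.
Unshelve. all: by end_near. Qed.

Section SphereFacts.
Variables (R : realType) (n : nat).
Implicit Types (x v : 'rV[R]_n) (X : set 'rV[R]_n).

Lemma sqnorm_ge0 x : 0 <= sqnorm x.
Proof. by apply: sumr_ge0 => i _; exact: sqr_ge0. Qed.

Lemma sqnormZ a x : sqnorm (a *: x) = a ^+ 2 * sqnorm x.
Proof. by rewrite /sqnorm mulr_sumr; apply: eq_bigr => i _; rewrite mxE exprMn. Qed.

Lemma sqnorm0 : sqnorm (0 : 'rV[R]_n) = 0.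
Proof. by rewrite -(scale0r 0) sqnormZ expr0n mul0r. Qed.

Lemma unit_sphereE x : unit_sphere x <-> sqnorm x = 1.
Proof.
rewrite /unit_sphere /= /euclidean_norm -/(sqnorm x); split=> [xE|->].
  by rewrite -[LHS]sqr_sqrtr ?sqnorm_ge0 // xE expr1n.
exact: sqrtr1.
Qed.

Lemma coord_sqr_le x i : x 0 i ^+ 2 <= sqnorm x.
Proof. by rewrite /sqnorm (bigD1 i) //= lerDl sumr_ge0 // => j _; exact: sqr_ge0. Qed.

Lemma row_normP x (M : R) : 0 <= M -> (`|x| <= M <-> forall i, `|x 0 i| <= M).
Proof.
move=> M0; rewrite [`|x|]mx_normrE; split=> [/bigmax_leP[_ h] i|h].
  by have := h (0, i) isT.
by apply/bigmax_leP; split=> // -[i j] _ /=; rewrite ord1.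
Qed.

Lemma sqnorm_norm_le x : sqnorm x <= n%:R * `|x| ^+ 2.
Proof.
rewrite /sqnorm -[n in n%:R]card_ord -sumr_const mulr_suml; apply: ler_sum => i _.
rewrite mul1r -real_normK ?num_real // lerXn2r ?nnegrE //.
by have := (row_normP x (normr_ge0 x)).1 (lexx _).
Qed.

Lemma norm_sqnorm_le x (M : R) : 0 <= M -> sqnorm x <= M ^+ 2 -> `|x| <= M.
Proof.
move=> M0 xM; apply/row_normP => // i.
rewrite -(ler_pXn2r (_ : (0 < 2)%N)) ?nnegrE // real_normK ?num_real //.
exact: le_trans (coord_sqr_le x i) xM.
Qed.

Lemma bounded_set_sqnormP X :
  bounded_set X <-> exists r, forall x, X x -> sqnorm x <= r.
Proof.
split=> [[M [_ XM]]|[r Xr]].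
  exists (n%:R * (M + 1) ^+ 2) => x Xx; apply: le_trans (sqnorm_norm_le x) _.
  have xM : `|x| <= M + 1 by apply: (XM (M + 1)); rewrite ?ltrDl.
  have M0 : 0 <= M + 1 by apply: le_trans xM.
  by rewrite ler_wpM2l // lerXn2r // nnegrE.
exists (`|r| + 1); split; first exact: num_real.
move=> M rM x Xx; apply: le_trans (ltW rM) => /=.
apply: norm_sqnorm_le; first by rewrite addr_ge0.
apply: le_trans (Xr x Xx) _; apply: le_trans (ler_norm r) _.
by have := normr_ge0 r; nra.
Qed.

Lemma row_cvg (T : Type) (F : set_system T) (FF : Filter F) (f : T -> 'rV[R]_n) (l : 'rV[R]_n) :
  (forall i, f x 0 i @[x --> F] --> l 0 i) -> f @ F --> l.
Proof.
move=> fl; apply/cvg_ballP => e e0.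
have : \forall x \near F, forall i, ball (l 0 i) e (f x 0 i).
  by apply: filter_forall => i; have /cvg_ballP := fl i; apply.
by apply: filterS => x hx; split=> // i j; rewrite ord1.
Qed.

Lemma continuous_sqnorm : continuous (@sqnorm R n).
Proof.
move=> x; have cadd : continuous (fun z : R * R => z.1 + z.2) by exact: add_continuous.
apply: (@cvg_big _ _ _ _ xpredT cadd _ (nbhs x)) => i _.
by apply: cvgM; exact: coord_continuous.
Qed.

Lemma compact_unit_sphere : compact (@unit_sphere R n).
Proof.
apply: bounded_closed_compact.
  by apply/bounded_set_sqnormP; exists 1 => x /unit_sphereE ->.
have -> : @unit_sphere R n = (@sqnorm R n) @^-1` [set 1].
  by apply/seteqP; split=> x /unit_sphereE.
apply: closed_comp => [x _|]; first exact: continuous_sqnorm.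
exact: closed_eq.
Qed.

Lemma rho_infty_preimageE X v (t : R) : 0 < t ->
  rho_infty_preimage X (v, t) <-> sqnorm v = 1 /\ X (t^-1 *: v).
Proof.
move=> t0; rewrite /rho_infty_preimage /rho_infty /=; split.
  by move=> [/unit_sphereE v1 _ [Xv _]].
move=> [v1 Xv]; split=> //; first exact/unit_sphereE.
split=> // v0; have := sqnormZ t^-1 v; rewrite v0 sqnorm0 v1 mulr1 => /esym/eqP.
by rewrite sqrf_eq0 invr_eq0 gt_eqF.
Qed.

Lemma boundary_inftyE X v (t : R) : boundary_infty X (v, t) <->
  [/\ t = 0, unit_sphere v & closure (rho_infty_preimage X) (v, 0)].
Proof.
rewrite /boundary_infty /strict_transform_infty; split.
  by move=> [[cl [u1 _]] [_ /= t0]]; rewrite t0 in cl.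
by move=> [-> u1 cl]; split; split=> //=.
Qed.

End SphereFacts.

(** * Parity of the number of ends *)

Section EvenNumberOfEnds.
Variables (R : realType) (n : nat) (X : set 'rV[R]_n).

Lemma model_point_continuous (d : {poly R}) (q : 'I_n -> {poly {poly R}})
    (T : Type) (F : set_system T) (FF : Filter F) (u v : T -> R) (c y : R) :
  d.[c] != 0 -> u @ F --> c -> v @ F --> y ->
  model_point d q (u x) (v x) @[x --> F] --> model_point d q c y.
Proof.
move=> dc uc vy; apply: row_cvg => i; rewrite mxE.
under eq_fun do rewrite mxE.
by apply: cvgM; [exact: cvg_horner2 | apply: cvgV => //; exact: cvg_horner].
Qed.

(** The slice of the preimage at height t is the part of X on the sphere of radius 1 / t, scaled by
    t; on that sphere f takes the value c = t^-2. Distinct roots give distinct points because h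
    recovers the root. *)
Theorem even_ends_parametrization :
  real_algebraic_set X ->
  (forall e P, prime_chain (vanishing_ideal X) P e -> (e <= 1)%N) ->
  ~ bounded_set X ->
  exists N (alpha : 'I_N -> R -> 'rV[R]_n) t0, [/\ ~~ odd N, 0 < t0,
    forall v t, 0 < t -> t < t0 ->
      (rho_infty_preimage X (v, t) <-> exists j, v = alpha j t),
    forall t, 0 < t -> t < t0 -> injective (fun j => alpha j t)
  & forall j (t : R), 0 < t -> t < t0 -> alpha j @ t --> alpha j t].
Proof.
move=> algX dimX unbX.
have unb r : exists2 x, X x & r < sqnorm x.
  apply: contrapT => nex; apply: unbX; apply/bounded_set_sqnormP; exists r => x Xx.
  by rewrite leNgt; apply/negP => rx; apply: nex; exists x.
have [P [D [h [d [q [D0 Dgood Dmod [r hr]]]]]]] := curve_model_at_infinity algX dimX unb.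
pose c0 := Num.max (cauchy_bound D) r.
have cb0 : 0 < cauchy_bound D by exact: cauchy_bound_gt0.
have Dpos c : c0 < c -> D.[c] != 0.
  rewrite /c0 gt_max => /andP[cc _].
  suff : c \in `[cauchy_bound D, +oo[ by move=> /(ge_cauchy_bound D0); rewrite rootE.
  by rewrite in_itv /= andbT ltW.
have Dneg c : c < - cauchy_bound D -> D.[c] != 0.
  move=> cc.
  suff : c \in `]-oo, - cauchy_bound D] by move=> /(le_cauchy_bound D0); rewrite rootE.
  by rewrite in_itv /= ltW.
have c0_gt0 : 0 < c0 by rewrite /c0 lt_max cb0.
have [||N [y [sN yroot yinj ycont]]] := @root_branches R P c0.
- by move=> c /Dpos/Dgood[].
- by move=> c /Dpos/Dgood[].
have evenN : ~~ odd N.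
  have cpos : c0 < c0 + 1 by rewrite ltrDl.
  have [_ lcp sepp] := Dgood _ (Dpos _ cpos).
  have -> : odd N = ~~ odd (size P).
    rewrite -(sN _ cpos) -(size_fiber lcp); apply: separable_roots_parity => //.
      exact: uniq_roots.
    by move=> x; rewrite mem_rootsR_fiber // root_fiber.
  have cneg : - cauchy_bound D - 1 < - cauchy_bound D by rewrite ltrBlDr ltrDl.
  have [_ lcn sepn] := Dgood _ (Dneg _ cneg).
  suff <- : odd (size ([::] : seq R)) = ~~ odd (size P) by [].
  rewrite -(size_fiber lcn); apply: separable_roots_parity => // x.
  rewrite root_fiber; apply/negbTE/eqP => Px.
  have [_ sq _] := Dmod _ _ (Dneg _ cneg) Px.
  have := sqnorm_ge0 (model_point d q (- cauchy_bound D - 1) x); rewrite sq.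
  by apply/negP; rewrite -ltNge; lra.
(* For t < t0 the inverse of t exceeds c0 + 1 > 1, so its square exceeds c0 too. *)
pose t0 := (c0 + 1)^-1.
have t0_gt0 : 0 < t0 by rewrite invr_gt0 ltr_pwDr // ltW.
have tc t : 0 < t -> t < t0 -> c0 < t ^- 2.
  move=> t_gt0 tt0; have tc1 : c0 + 1 < t^-1.
    by rewrite -[ltLHS]invrK ltf_pV2 // posrE.
  by rewrite -exprVn; nra.
exists N, (fun j t => t *: model_point d q (t ^- 2) (y j (t ^- 2))), t0; split=> //.
- move=> v t t_gt0 tt0; have ct := tc t t_gt0 tt0.
  have tn0 : t != 0 by rewrite gt_eqF.
  rewrite rho_infty_preimageE //; split=> [[v1 Xv]|[j ->]].
    have sqv : sqnorm (t^-1 *: v) = t ^- 2 by rewrite sqnormZ v1 mulr1 exprVn.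
    have [|Pv mv] := hr _ Xv.
      by rewrite sqv; apply: le_lt_trans ct; rewrite /c0 le_max lexx orbT.
    rewrite sqv in Pv mv; have [j hj] := (yroot _ _ ct).1 Pv.
    by exists j; rewrite -hj mv scalerA mulfV // scale1r.
  have Py : P.[y j (t ^- 2), t ^- 2] = 0 by apply/yroot => //; exists j.
  have [Xm sqm _] := Dmod _ _ (Dpos _ ct) Py.
  rewrite sqnormZ sqm mulfV ?expf_neq0 //; split=> //.
  by rewrite scalerA mulVf // scale1r.
- move=> t t_gt0 tt0 i j /= mij; have ct := tc t t_gt0 tt0.
  apply: (yinj _ ct) => /=.
  have Py k : P.[y k (t ^- 2), t ^- 2] = 0 by apply/yroot => //; exists k.
  have [_ _ <-] := Dmod _ _ (Dpos _ ct) (Py i).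
  have [_ _ <-] := Dmod _ _ (Dpos _ ct) (Py j).
  have := congr1 (fun v => t^-1 *: v) mij.
  by rewrite /= !scalerA mulVf ?gt_eqF // !scale1r => ->.
- move=> j t t_gt0 tt0; have ct := tc t t_gt0 tt0.
  have invc : (fun s : R => s ^- 2) @ t --> t ^- 2.
    apply: cvgV; first by rewrite expf_neq0 // gt_eqF.
    by apply: (@cvgM _ _ (nbhs t) _ id id); exact: cvg_id.
  apply: cvgZ; first exact: cvg_id.
  apply: model_point_continuous => //; first by have [] := Dgood _ (Dpos _ ct).
  by apply: (@cvg_comp _ _ _ (fun s => s ^- 2) (y j) _ (nbhs (t ^- 2))) => //; exact: ycont.
Qed.

(** The list s contains all possible limits of the arcs, so each arc converges to one of its
    members; the entries of eta count the arcs by their limit, and their sum is N. *)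
Theorem even_norm1_k_infty (eta : seq nat) :
  real_algebraic_set X ->
  (forall e P, prime_chain (vanishing_ideal X) P e -> (e <= 1)%N) ->
  ~ bounded_set X -> k_infty_eq X eta -> ~~ odd (norm1 eta).
Proof.
move=> algX dimX unbX [s [us bdE sE _ germ]].
have [N [alpha [t0 [evenN t0_gt0 Yarcs ainj acont]]]] :=
  even_ends_parametrization algX dimX unbX.
have Y_gt0 z : rho_infty_preimage X z -> 0 < z.2 by case.
have closs v : unit_sphere v -> closure (rho_infty_preimage X) (v, 0) -> v \in s.
  move=> v1 cl; have : boundary_infty X (v, 0) by apply/boundary_inftyE.
  by rewrite bdE => -[a /= sa [<-]].
have /choice[l lP] : forall j, exists a, a \in s /\ alpha j t @[t --> 0^'+] --> a.
  move=> j; have [||||a sa la] := @arc_limit R 'rV[R]_n (@unit_sphere R n) s (alpha j) t0 t0_gt0.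
  - exact: compact_unit_sphere.
  - exact: acont.
  - move=> t t_gt0 tt0; apply/unit_sphereE.
    have /rho_infty_preimageE[//|//] : rho_infty_preimage X (alpha j t, t).
    by apply/Yarcs => //; exists j.
  - move=> v v1 /negP nvs; apply: contrapT => nex; apply: nvs; apply: closs => //.
    move=> B /nbhs_ballP[e /= e0 eB]; apply: contrapT => /set0P/negP/negPn/eqP YB.
    apply: nex; exists e => //; near=> t => bt.
    have t_gt0 : 0 < t by near: t; exact: nbhs_right_gt.
    have tt0 : t < t0 by near: t; exact: nbhs_right_lt.
    have te : t < e by near: t; exact: nbhs_right_lt.
    suff : (rho_infty_preimage X `&` B) (alpha j t, t) by rewrite YB.
    split; first by apply/Yarcs => //; exists j.
    apply: eB; split=> //=.
    by rewrite -ball_normE /= sub0r normrN gtr0_norm.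
  - by exists a.
have etaE i : (i < size s)%N -> nth 0%N eta i = #|[pred j | l j == nth 0 s i]|.
  move=> si; have g1 := germ i si.
  have g2 := germ_components_arcs t0_gt0 Y_gt0 Yarcs ainj acont (fun j => (lP j).2) (nth 0 s i).
  have [e [c1 c2]] := filter_ex (filterI g1 g2).
  by apply/card_eq_II; apply: card_eq_trans c2; rewrite card_eq_sym.
suff -> : norm1 eta = N by [].
rewrite /norm1 (big_nth 0%N) -sE big_mkord.
transitivity (\sum_(i < size s) \sum_(j < N) (l j == nth 0%R s i))%N.
  by apply: eq_bigr => i _; rewrite etaE // -sum1_card big_mkcond.
rewrite exchange_big /= -[RHS]card_ord -sum1_card; apply: eq_bigr => j _.
have [/(nthP 0)[i si li] _] := lP j.
rewrite (bigD1 (Ordinal si)) //= li eqxx big1 // => k ki.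
apply/eqP; rewrite eqb0 -li nth_uniq //; apply: contraNN ki => /eqP ik.
by apply/eqP/val_inj.
Unshelve. all: by end_near. Qed.

End EvenNumberOfEnds.

(** * Realization of the even sequences *)

Lemma poly_eq0_on_ball (R : realType) (p : {poly R}) (a e : R) : 0 < e ->
  (forall s, ball a e s -> p.[s] = 0) -> p = 0.
Proof.
move=> e0 pa; apply/eqP/negPn/negP => p0.
pose rs := [seq a + e / k.+2%:R | k <- iota 0 (size p)].
have ur : uniq rs.
  rewrite map_inj_uniq ?iota_uniq // => i j /addrI /(mulfI (lt0r_neq0 e0)).
  by move=> /invr_inj/eqP; rewrite eqr_nat => /eqP [].
suff rr : all (root p) rs.
  by have := max_poly_roots p0 rr ur; rewrite size_map size_iota ltnn.
apply/allP => _ /mapP[k _ ->]; apply/eqP/pa.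
rewrite -ball_normE /= opprD addrA subrr add0r normrN gtr0_norm ?divr_gt0 //.
by rewrite ltr_pdivrMr // ltr_pMr // ltr1n.
Qed.

(** * Dimension of a finite union of polynomially parametrized curves *)

Section PolynomialCurves.
Variables (R : realType) (n : nat) (J : finType) (gam : J -> 'I_n -> {poly R}).
Variable (H : J -> mpoly.mpoly n R).
Local Notation mp := (mpoly.mpoly n R).

Definition curve_pullback (c : J) : mp -> {poly R} := mpoly.mmap (@polyC R) (gam c).
HB.instance Definition _ c := GRing.RMorphism.on (curve_pullback c).

Hypothesis H_param : forall c, curve_pullback c (H c) = 'X.

Lemma horner_curve_pullback c p s :
  (curve_pullback c p).[s] = mpoly.meval (fun i => (gam c i).[s]) p.
Proof.
rewrite /curve_pullback /mpoly.mmap mpoly.mevalE horner_sum; apply: eq_bigr => m _.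
rewrite hornerM hornerC /mpoly.mmap1 horner_prod; congr (_ * _).
by apply: eq_bigr => i _; rewrite horner_exp.
Qed.

Lemma curve_pullback_surj c g : exists p, curve_pullback c p = g.
Proof.
elim/poly_ind: g => [|g a [p pE]]; first by exists 0; rewrite rmorph0.
exists (p * H c + mpoly.mpolyC n a).
by rewrite rmorphD rmorphM /= H_param pE /curve_pullback mpoly.mmapC.
Qed.

(** Modulo the kernel the ring is R[s], where nonzero primes are maximal. Take m in P1 with nonzero
    pullback of least degree, g in P2 but not in P1, and the gcd of their pullbacks: by primality of
    P1 and minimality of m it is constant, so a Bezout relation puts 1 in P2. *)
Lemma prime_over_curve_kernel (c : J) (P0 P1 P2 : {pred mp}) :
  prime_ideal P0 -> prime_ideal P1 -> prime_ideal P2 ->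
  (forall p, curve_pullback c p = 0 -> p \in P0) ->
  {subset P0 <= P1} -> ~ {subset P1 <= P0} ->
  {subset P1 <= P2} -> ~ {subset P2 <= P1} -> False.
Proof.
move=> h0 h1 h2 kerP0 s01 n10 s12 n21.
have [I10 I1D I1M] := prime_is_ideal h1.
have [I20 I2D I2M] := prime_is_ideal h2.
have [m [mP1 mn]] : exists m, m \in P1 /\ curve_pullback c m != 0.
  apply: contrapT => nex; apply: n10 => m mP1; apply: kerP0; apply/eqP.
  by apply: contrapT => mn; apply: nex; exists m; split=> //; apply/negP.
have [g [gP2 gP1]] : exists g, g \in P2 /\ g \notin P1.
  apply: contrapT => nex; apply: n21 => g gP2.
  by apply: contrapT => gP1; apply: nex; exists g; split=> //; apply/negP.
pose ok k := `[< exists m, [/\ m \in P1, curve_pullback c m != 0 &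
  size (curve_pullback c m) = k] >].
have : exists k, ok k by exists (size (curve_pullback c m)); apply/asboolP; exists m.
case/ex_minnP => k /asboolP[{mP1 mn}m [mP1 mn sm]] kmin.
pose d := gcdp (curve_pullback c m) (curve_pullback c g).
have /dvdpP[e mE] : d %| curve_pullback c m by exact: dvdp_gcdl.
have /dvdpP[f gE] : d %| curve_pullback c g by exact: dvdp_gcdr.
have [d' d'E] := curve_pullback_surj c d.
have [e' e'E] := curve_pullback_surj c e.
have [f' f'E] := curve_pullback_surj c f.
have inP1 u v : curve_pullback c u = curve_pullback c v -> v \in P1 -> u \in P1.
  move=> uv vP; rewrite -(subrK v u); apply: I1D => //; apply: s01; apply: kerP0.
  by rewrite rmorphB /= uv subrr.
have : e' * d' \in P1 by apply: inP1 mP1; rewrite rmorphM /= e'E d'E mE.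
move=> /(prime_idealM h1)/orP[e'P|d'P]; last first.
  move/negP: gP1; apply; apply: (inP1 _ (f' * d')); last exact: I1M.
  by rewrite rmorphM /= f'E d'E gE.
have en : e != 0 by apply: contraNneq mn; rewrite mE => ->; rewrite mul0r.
have dn : d != 0 by apply: contraNneq mn; rewrite mE => ->; rewrite mulr0.
have : (k <= size e)%N by apply: kmin; apply/asboolP; exists e'; rewrite e'E.
rewrite -sm mE size_mul // => se.
have : size d == 1%N.
  rewrite -size_poly_gt0 in dn; move: se; rewrite -(prednK dn) addnS /=.
  by rewrite -{2}[size e]addn0 leq_add2l leqn0 => /eqP->.
rewrite -/(coprimep _ _) => /Bezout_eq1_coprimepP[[u v] /= uv].
have [u' u'E] := curve_pullback_surj c u.
have [v' v'E] := curve_pullback_surj c v.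
have /negP := prime_ideal1 h2; apply.
have -> : 1 = (1 - (u' * m + v' * g)) + (u' * m + v' * g) by rewrite subrK.
have inP2 : 1 - (u' * m + v' * g) \in P2.
  apply/s12/s01/kerP0; rewrite rmorphB rmorph1 rmorphD !rmorphM /=.
  by rewrite u'E v'E uv subrr.
exact: (I2D _ _ inP2 (I2D _ _ (I2M _ _ (s12 _ mP1)) (I2M _ _ gP2))).
Qed.

(** The vanishing ideal is the intersection of the kernels of the curves that meet A, because [T c]
    is Zariski dense when nonempty. The ideal of a point over such a kernel gives a chain of length
    one; conversely the first prime of any chain contains one of these kernels. *)
Lemma has_dim_polynomial_curves (A : set 'rV[R]_n) (T : J -> set R) :
  A !=set0 ->
  (forall x, A x <-> exists c s, T c s /\ x = \row_i (gam c i).[s]) ->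
  (forall c, T c !=set0 -> forall p : {poly R}, (forall s, T c s -> p.[s] = 0) -> p = 0) ->
  has_dim A 1.
Proof.
move=> [x0 Ax0] AT Tdense.
have rowE c s : (\row_i (gam c i).[s] : 'rV[R]_n) 0 = fun i => (gam c i).[s].
  by apply/funext => i; rewrite mxE.
have van p : vanishing_ideal A p <-> forall c, T c !=set0 -> curve_pullback c p = 0.
  split=> [Ip c Tc|Ip x /AT[c [s [Ts ->]]]].
    apply: (Tdense c Tc) => s Ts; rewrite horner_curve_pullback -rowE.
    by apply: Ip; apply/AT; exists c, s.
  rewrite rowE -horner_curve_pullback Ip ?horner0 //.
  by exists s.
have [c0 [s0 [T0 x0E]]] := (AT x0).1 Ax0.
split.
  pose Q0 : {pred mp} := fun p => curve_pullback c0 p == 0.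
  pose Q1 : {pred mp} := fun p => (curve_pullback c0 p).[s0] == 0.
  exists (fun i => if i is 0%N then Q0 else Q1); split.
  - move=> [|[|//]] _; split; rewrite ?/idealr_closed ?/prime_idealr_closed.
    + split; rewrite ?unfold_in ?rmorph0 ?rmorph1 ?oner_eq0 //.
      move=> a u v; rewrite !unfold_in => /eqP u0 /eqP v0.
      by rewrite rmorphD rmorphM /= u0 v0 mulr0 addr0.
    + by move=> u v; rewrite !unfold_in rmorphM mulf_eq0.
    + split; rewrite ?unfold_in ?rmorph0 ?rmorph1 ?horner0 ?hornerC ?oner_eq0 //.
      move=> a u v; rewrite !unfold_in => /eqP u0 /eqP v0.
      by rewrite rmorphD rmorphM /= hornerD hornerM u0 v0 mulr0 addr0.
    + by move=> u v; rewrite !unfold_in rmorphM hornerM mulf_eq0.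
  - move=> p /van Ip; rewrite unfold_in Ip //.
    by exists s0.
  - move=> [|//] _; split=> [p|sub].
      by rewrite !unfold_in => /eqP->; rewrite horner0.
    have := sub (H c0 - mpoly.mpolyC n s0).
    rewrite !unfold_in rmorphB /= H_param /curve_pullback mpoly.mmapC.
    by rewrite hornerXsubC subrr eqxx polyXsubC_eq0 => /(_ isT).
move=> e P [hP IP str]; rewrite leqNgt; apply/negP => e1.
have [c [Tc kerc]] : exists c, T c !=set0 /\
    forall p, curve_pullback c p = 0 -> p \in P 0%N.
  apply: contrapT => nex.
  have /choice[g gP] : forall c, exists g, T c !=set0 ->
      curve_pullback c g = 0 /\ g \notin P 0%N.
    move=> c; have [Tc|nTc] := pselect (T c !=set0); last by exists 0.
    apply: contrapT => ng; apply: nex; exists c; split=> // p p0.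
    by apply: contrapT => pP; apply: ng; exists p => _; split=> //; apply/negP.
  have : \prod_(c | `[< T c !=set0 >]) g c \in P 0%N.
    apply: IP; apply/van => c Tc; rewrite (bigD1 c) /=; last exact: asboolT.
    by rewrite rmorphM /= (gP c Tc).1 mul0r.
  have h0 := hP 0%N isT.
  elim/big_rec: _ => [|c' p /asboolP Tc' IH].
    by apply/negP; exact: prime_ideal1 h0.
  move=> /(prime_idealM h0)/orP[|//].
  by apply/negP; case: (gP c' Tc').
have [s01 n10] := str 0%N (ltn_trans (ltnSn 0) e1).
have [s12 n21] := str 1%N e1.
by apply: (@prime_over_curve_kernel c (P 0%N) (P 1%N) (P 2%N)) => //;
  apply: hP => //; exact: ltnW.
Qed.

End PolynomialCurves.

Section DirectionAssignment.
Local Open Scope nat_scope.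
Variable eta : seq nat.
Local Notation r := (size eta).
Implicit Types i : 'I_r.

Definition mult i := nth 0 eta i.
Definition odd_rank i := count odd (take i eta).

Lemma odd_norm1 (s : seq nat) : odd (norm1 s) = odd (count odd s).
Proof.
rewrite /norm1; elim: s => [|x s IH]; first by rewrite big_nil.
by rewrite big_cons /= !oddD IH; case: (odd x).
Qed.

Lemma mult_le_norm1 i : mult i <= norm1 eta.
Proof.
by rewrite /norm1 (big_nth 0) big_mkord (bigD1 i) //= leq_addr.
Qed.

Lemma odd_rank_le i : odd_rank i <= i.
Proof.
apply: leq_trans (count_size _ _) _.
by rewrite size_take ltn_ord.
Qed.

Lemma odd_rank_lt i k : odd (mult i) -> i < k -> odd_rank i < count odd (take k eta).
Proof.
move=> oi ik; have -> : take k eta = take i.+1 eta ++ drop i.+1 (take k eta).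
  by rewrite -[LHS](cat_take_drop i.+1) -take_min (minn_idPl ik).
rewrite count_cat (take_nth 0) // -cats1 count_cat /= oi /odd_rank; lia.
Qed.

Lemma odd_rank_surj (s : seq nat) m : m < count odd s ->
  exists k, [/\ k < size s, odd (nth 0 s k) & count odd (take k s) = m].
Proof.
elim: s m => [|x s IH] m //=.
case: (boolP (odd x)) => [ox|nx].
  case: m => [_|m]; first by exists 0; rewrite /= ox.
  rewrite add1n ltnS => /IH[i [si oi ci]]; exists i.+1; split=> //=.
  by rewrite ox ci.
rewrite add0n => /IH[i [si oi ci]]; exists i.+1; split=> //=.
by rewrite (negPf nx).
Qed.

(* Two positions with odd multiplicities share an axis when their ranks among
   the odd entries are 2m and 2m+1; these are the two ends of a line. *)
Definition axis_index i := if odd (mult i) then (odd_rank i)./2 else r + i.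
Definition axis_sign i := odd (mult i) && odd (odd_rank i).

Lemma axis_index_lt i : axis_index i < r + r.
Proof.
rewrite /axis_index; case: odd; last by rewrite ltn_add2l.
by have := odd_rank_le i; have := ltn_ord i; lia.
Qed.

Lemma axis_inj i i' : axis_index i = axis_index i' ->
  axis_sign i = axis_sign i' -> i = i'.
Proof.
rewrite /axis_index /axis_sign.
have li := ltn_ord i; have li' := ltn_ord i'.
have ri := odd_rank_le i; have ri' := odd_rank_le i'.
case: (boolP (odd (mult i))) => oi; case: (boolP (odd (mult i'))) => oi' /=.
- move=> half_eq odd_eq; have rk : odd_rank i = odd_rank i'.
    by rewrite -[LHS]odd_double_half -[RHS]odd_double_half half_eq odd_eq.
  apply/val_inj; case: (ltngtP i i') => // ii'.
    by have := odd_rank_lt oi ii'; rewrite -/(odd_rank i') rk ltnn.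
  by have := odd_rank_lt oi' ii'; rewrite -/(odd_rank i) rk ltnn.
- by lia.
- by lia.
- by move=> /addnI/val_inj.
Qed.

Lemma opposite_position i : ~~ odd (norm1 eta) -> odd (mult i) ->
  exists i', [/\ odd (mult i'), axis_index i' = axis_index i &
                 axis_sign i' = ~~ axis_sign i].
Proof.
rewrite odd_norm1 => ev oi.
have ci := odd_rank_lt oi (ltn_ord i); rewrite take_size in ci.
pose m := if odd (odd_rank i) then (odd_rank i).-1 else (odd_rank i).+1.
have [|k [kr ok ck]] := @odd_rank_surj eta m.
  by rewrite /m; case: (boolP (odd (odd_rank i))) => o; lia.
exists (Ordinal kr).
have rk : odd_rank (Ordinal kr) = m by [].
have ok' : odd (mult (Ordinal kr)) by [].
rewrite /axis_index /axis_sign ok' oi rk /= /m; split=> //.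
  by case: (boolP (odd (odd_rank i))) => o; lia.
by case: (boolP (odd (odd_rank i))) => o; lia.
Qed.

(* The curves attached to position i are numbered by their parameter p; the
   line p = 0 is used once when the multiplicity is odd. *)
Definition curve_ok i p := ~~ odd (mult i) <= p <= (mult i)./2.

Definition end_code i (l : 'I_(mult i)) := l + ~~ odd (mult i).

Lemma end_curve_ok i l : curve_ok i (uphalf (@end_code i l)).
Proof.
rewrite /curve_ok /end_code; have := ltn_ord l.
by case: (boolP (odd (mult i))) => o /=; lia.
Qed.

Lemma end_code_surj i p (q : bool) : curve_ok i p -> (p == 0 -> ~~ q) ->
  exists l, uphalf (@end_code i l) = p /\ odd (end_code l) = q.
Proof.
rewrite /curve_ok => pok pq.
have lt : p.*2 - q - ~~ odd (mult i) < mult i.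
  by case: (boolP (odd (mult i))) pok => o /= pok; case: q pq => pq; lia.
exists (Ordinal lt); rewrite /end_code /=.
by case: (boolP (odd (mult i))) pok lt => o /= pok lt; case: q pq lt => pq lt; lia.
Qed.

Lemma end_code_inj i (l l' : 'I_(mult i)) :
  uphalf (end_code l) = uphalf (end_code l') ->
  (uphalf (end_code l) = 0 \/ odd (end_code l) = odd (end_code l')) -> l = l'.
Proof.
move=> u h; apply/val_inj/(@addIn (~~ odd (mult i))).
rewrite -/(end_code l) -/(end_code l'); move: (end_code l) (end_code l') u h.
by move=> a b u [h|h]; lia.
Qed.

End DirectionAssignment.

Section Realization.
Variables (R : realType) (eta : seq nat).
Local Notation r := (size eta).
Local Notation n := (r + r)%N.+1.
Implicit Types (i : 'I_r) (x v : 'rV[R]_n) (p : nat) (q : bool) (t : R).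

Definition axis i : 'I_n := inord (axis_index i).
Definition bend : 'I_n := ord_max.
Definition sg i : R := (-1) ^+ axis_sign i.

Lemma axis_neq_bend i : axis i != bend.
Proof.
have lt := axis_index_lt i.
by rewrite -val_eqE /= inordK ?ltnS ?ltn_eqF // ltnW.
Qed.

Lemma axis_eq i i' : (axis i == axis i') = (axis_index i == axis_index i').
Proof.
have lt (j : 'I_r) : (axis_index j < n)%N by rewrite ltnS ltnW ?axis_index_lt.
by rewrite -val_eqE /= !inordK.
Qed.

Lemma sg_sqr i : sg i ^+ 2 = 1.
Proof. by rewrite /sg sqrr_sign. Qed.

Definition on_curve i p x := (forall k, k != axis i -> k != bend -> x 0 k = 0) /\
  x 0 bend ^+ 2 = p%:R ^+ 2 + 2 * p%:R * sg i * x 0 (axis i).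

(* For p > 0, on_curve i p is the parabola with focus 0 and parameter p opening
   in the direction of position i; for p = 0 it is the line through 0. *)
Definition realization : set 'rV[R]_n :=
  [set x | exists i p, curve_ok i p /\ on_curve i p x].

(* The point at distance 1 / t from 0 on branch q of that curve, times t. *)
Definition end_point i p q t : 'rV[R]_n := \row_k
  ((1 - p%:R * t) * sg i * (k == axis i)%:R +
   (-1) ^+ q * Num.sqrt (p%:R * t * (2 - p%:R * t)) * (k == bend)%:R).

Lemma end_point_axis i p q t : end_point i p q t 0 (axis i) = (1 - p%:R * t) * sg i.
Proof. by rewrite mxE eqxx (negPf (axis_neq_bend i)) mulr1 mulr0 addr0. Qed.

Lemma end_point_bend i p q t : end_point i p q t 0 bend =
  (-1) ^+ q * Num.sqrt (p%:R * t * (2 - p%:R * t)).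
Proof. by rewrite mxE eqxx eq_sym (negPf (axis_neq_bend i)) mulr1 mulr0 add0r. Qed.

Lemma end_point_other i p q t k : k != axis i -> k != bend -> end_point i p q t 0 k = 0.
Proof. by move=> /negPf ki /negPf kb; rewrite mxE ki kb !mulr0 addr0. Qed.

Lemma sqnorm_plane i v : (forall k, k != axis i -> k != bend -> v 0 k = 0) ->
  sqnorm v = v 0 (axis i) ^+ 2 + v 0 bend ^+ 2.
Proof.
move=> v0; rewrite /sqnorm (bigD1 (axis i)) //= (bigD1 bend) /=; last first.
  by rewrite eq_sym axis_neq_bend.
by rewrite big1 ?addr0 // => k /andP[ki kb]; rewrite v0 // expr0n.
Qed.

Lemma end_point_sqrt p q t : 0 <= p%:R * t <= 2 ->
  ((-1) ^+ q * Num.sqrt (p%:R * t * (2 - p%:R * t))) ^+ 2 = p%:R * t * (2 - p%:R * t).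
Proof.
by move=> /andP[pt0 pt2]; rewrite exprMn sqrr_sign mul1r sqr_sqrtr // mulr_ge0 // subr_ge0.
Qed.

Lemma end_point_unit i p q t : 0 <= p%:R * t <= 2 -> sqnorm (end_point i p q t) = 1.
Proof.
move=> pt; rewrite (@sqnorm_plane i) => [|k]; last exact: end_point_other.
rewrite end_point_axis end_point_bend end_point_sqrt // exprMn sg_sqr; ring.
Qed.

Lemma end_point_on_curve i p q t : 0 < t -> p%:R * t <= 2 ->
  on_curve i p (t^-1 *: end_point i p q t).
Proof.
move=> t0 pt; have tn0 : t != 0 by rewrite gt_eqF.
split=> [k ki kb|]; first by rewrite mxE end_point_other // mulr0.
rewrite !mxE -!/(end_point i p q t 0 _).
have := end_point_bend i p q t; rewrite mxE => ->.
have := end_point_axis i p q t; rewrite mxE => ->.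
rewrite exprMn end_point_sqrt; last by rewrite pt andbT mulr_ge0 // ltW.
rewrite (_ : 2 * _ * _ * _ = 2 * p%:R * (1 - p%:R * t) * t^-1 * sg i ^+ 2); last by ring.
by rewrite sg_sqr; field.
Qed.

Lemma on_curve_end_point i p v t : 0 < t -> sqnorm v = 1 ->
  on_curve i p (t^-1 *: v) ->
  (exists q, v = end_point i p q t) \/
  [/\ p = 0%N & v = \row_k (- sg i * (k == axis i)%:R)].
Proof.
move=> t0 v1 [v0 vb]; have tn0 : t != 0 by rewrite gt_eqF.
have {}v0 k : k != axis i -> k != bend -> v 0 k = 0.
  move=> ki kb; have /eqP := v0 k ki kb.
  by rewrite mxE mulf_eq0 invr_eq0 (negPf tn0) => /eqP.
rewrite (sqnorm_plane v0) in v1; rewrite !mxE in vb.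
set u := v 0 (axis i) in v1 vb; set w := v 0 bend in v1 vb.
have {}vb : w ^+ 2 = (p%:R * t) ^+ 2 + 2 * (p%:R * t) * (sg i * u).
  transitivity (t ^+ 2 * (t^-1 * w) ^+ 2); first by field.
  by rewrite vb; field.
have s1 := sg_sqr i; set s := sg i in s1 vb.
have uE : u = s * (s * u) by rewrite mulrA -expr2 s1 mul1r.
set z := s * u in vb uE; set P := p%:R * t in vb.
have zu : z ^+ 2 = u ^+ 2 by rewrite /z exprMn s1 mul1r.
have pt0 : 0 <= P by rewrite mulr_ge0 // ltW.
have vE (f : 'I_n -> R) : f (axis i) = u -> f bend = w ->
    (forall k, k != axis i -> k != bend -> f k = 0) -> v = \row_k f k.
  move=> fi fb f0; apply/rowP => k; rewrite mxE.
  have [->|ki] := eqVneq k (axis i); first by rewrite fi.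
  have [->|kb] := eqVneq k bend; first by rewrite fb.
  by rewrite v0 // f0.
have : (z + P - 1) * (z + P + 1) = 0.
  transitivity (z ^+ 2 + w ^+ 2 - 1); first by rewrite vb; ring.
  by rewrite zu v1 subrr.
move/eqP; rewrite mulf_eq0 => /orP[/eqP zP|/eqP zP].
  left; exists (w < 0).
  have zE : z = 1 - P by lra.
  apply: vE.
  - by rewrite eqxx (negPf (axis_neq_bend i)) mulr1 mulr0 addr0 -/P -zE mulrC uE.
  - rewrite eqxx eq_sym (negPf (axis_neq_bend i)) mulr1 mulr0 add0r -/P.
    have -> : P * (2 - P) = w ^+ 2 by rewrite vb zE; ring.
    by rewrite sqrtr_sqr [RHS]numEsign.
  - by move=> k /negPf-> /negPf->; rewrite !mulr0 addr0.
right; have zE : z = - 1 - P by lra.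
have P0 : P = 0.
  have : 0 <= w ^+ 2 by exact: sqr_ge0.
  by rewrite vb zE; nra.
split.
  by move/eqP: P0; rewrite /P mulf_eq0 (negPf tn0) orbF pnatr_eq0 => /eqP.
apply: vE.
- by rewrite eqxx mulr1 uE zE P0 -/s; ring.
- rewrite eq_sym (negPf (axis_neq_bend i)) mulr0; apply/esym/eqP.
  by rewrite -sqrf_eq0 vb P0; apply/eqP; ring.
- by move=> k /negPf-> _; rewrite mulr0.
Qed.

Lemma end_point_continuous i p q t : end_point i p q @ t --> end_point i p q t.
Proof.
apply: row_cvg => k; rewrite mxE; under eq_fun do rewrite mxE.
have pc : (fun s : R => p%:R * s) @ t --> p%:R * t.
  by apply: cvgM; [exact: cvg_cst | exact: cvg_id].
apply: cvgD; apply: cvgM; try exact: cvg_cst; apply: cvgM; try exact: cvg_cst.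
  by apply: cvgB => //; exact: cvg_cst.
apply: (@cvg_comp _ _ _ (fun s => p%:R * s * (2 - p%:R * s)) Num.sqrt); last first.
  exact: sqrt_continuous.
by apply: cvgM => //; apply: cvgB => //; exact: cvg_cst.
Qed.

Definition direction i : 'rV[R]_n := \row_k (sg i * (k == axis i)%:R).

Lemma end_point_lim i p q : end_point i p q t @[t --> 0^'+] --> direction i.
Proof.
have -> : direction i = end_point i p q 0.
  by apply/rowP => k; rewrite !mxE !(mulr0, subr0, mul0r, sqrtr0, addr0, mul1r).
by apply: cvg_at_right_filter; exact: end_point_continuous.
Qed.

Lemma direction_inj : injective direction.
Proof.
move=> i i' /rowP dd.
have sn0 (j : 'I_r) : sg j != 0 by rewrite /sg signr_eq0.
have ax : axis i = axis i'.
  have := dd (axis i); rewrite !mxE eqxx mulr1.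
  by case: eqVneq => // _ /eqP; rewrite mulr0 (negPf (sn0 i)).
apply: axis_inj; first by apply/eqP; rewrite -axis_eq ax.
have := dd (axis i); rewrite !mxE ax eqxx !mulr1.
exact: signr_inj.
Qed.

Lemma direction_unit i : sqnorm (direction i) = 1.
Proof.
rewrite (@sqnorm_plane i) => [|k /negPf ki _]; last by rewrite mxE ki mulr0.
rewrite !mxE eqxx eq_sym (negPf (axis_neq_bend i)) mulr1 mulr0 expr0n addr0.
exact: sg_sqr.
Qed.

Lemma end_point_inj i i' p p' q q' t : 0 < t -> p%:R * t < 1 -> p'%:R * t < 1 ->
  end_point i p q t = end_point i' p' q' t ->
  [/\ i = i', p = p' & p = 0%N \/ q = q'].
Proof.
move=> t0 pt p't ee.
have sn0 (j : 'I_r) : sg j != 0 by rewrite /sg signr_eq0.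
have ax : axis i = axis i'.
  apply/eqP; apply: contraT => ii'.
  have := end_point_axis i p q t.
  rewrite ee end_point_other ?axis_neq_bend // => /esym/eqP.
  by rewrite mulf_eq0 (negPf (sn0 i)) orbF gt_eqF // subr_gt0.
have e1 : (1 - p%:R * t) * sg i = (1 - p'%:R * t) * sg i'.
  by have := end_point_axis i p q t; rewrite ee ax end_point_axis.
have sgE : sg i = sg i'.
  have := congr1 Num.sg e1; rewrite !sgrM.
  have -> : Num.sg (1 - p%:R * t) = 1 by rewrite gtr0_sg // subr_gt0.
  have -> : Num.sg (1 - p'%:R * t) = 1 by rewrite gtr0_sg // subr_gt0.
  rewrite !mul1r; have sgsg (j : 'I_r) : Num.sg (sg j) = sg j.
    by rewrite /sg; case: axis_sign; rewrite ?sgrN sgr1.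
  by rewrite !sgsg.
have ii' : i = i'.
  by apply: direction_inj; rewrite /direction sgE ax.
have pp' : p = p'.
  move: e1; rewrite sgE => /(mulIf (sn0 i'))/addrI/oppr_inj/(mulIf (lt0r_neq0 t0))/eqP.
  by rewrite eqr_nat => /eqP.
split=> //; have [p0|pn0] := eqVneq p 0%N; [by left | right].
have := end_point_bend i p q t; rewrite ee end_point_bend -pp'.
have p_gt0 : 0 < p%:R * t by rewrite mulr_gt0 // ltr0n lt0n.
have sq0 : Num.sqrt (p%:R * t * (2 - p%:R * t)) != 0.
  by rewrite gt_eqF // sqrtr_gt0 mulr_gt0 // subr_gt0; lra.
by move/(mulIf sq0)/signr_inj.
Qed.

End Realization.

Section RealizationInvariant.
Variables (R : realType) (eta : seq nat).
Local Notation r := (size eta).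
Local Notation n := (r + r)%N.+1.
Implicit Types (i : 'I_r) (x v : 'rV[R]_n) (p : nat) (q : bool) (t : R).
Local Notation sg := (sg R).
Local Notation bend := (bend eta).
Local Notation realization := (@realization R eta).
Local Notation direction := (direction R).

Definition curve_coord i p (k : 'I_n) : {poly R} :=
  if k == bend then (if p == 0%N then 0 else 'X) else
  if k == axis i then
    (if p == 0%N then 'X else (sg i / (2 * p%:R)) *: ('X^2 - (p%:R ^+ 2)%:P))
  else 0.

Lemma on_curveP i p x : on_curve i p x <->
  exists s, x = \row_k (curve_coord i p k).[s].
Proof.
have ab := axis_neq_bend i; have s1 := sg_sqr R i.
split=> [[x0 xb]|[s ->]]; last first.
  split=> [k /negPf ki /negPf kb|]; first by rewrite mxE /curve_coord kb ki horner0.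
  rewrite !mxE /curve_coord eqxx (negPf ab) eqxx.
  have [->|pn0] := eqVneq p 0%N; first by rewrite horner0 !expr0n /= !mulr0 !mul0r addr0.
  have pr0 : p%:R != 0 :> R by rewrite pnatr_eq0.
  rewrite hornerX hornerZ hornerD hornerN hornerC hornerXn.
  rewrite (_ : 2 * _ * _ * _ = sg i ^+ 2 * (s ^+ 2 - p%:R ^+ 2)); last by field.
  by rewrite s1; ring.
exists (if p == 0%N then x 0 (axis i) else x 0 bend); apply/rowP => k.
rewrite mxE /curve_coord; have [->|kb] := eqVneq k bend.
  have [p0|pn0] := eqVneq p 0%N; last by rewrite hornerX.
  rewrite horner0; apply/eqP; rewrite -sqrf_eq0 xb p0.
  by rewrite expr0n /= mulr0 !mul0r addr0.
have [->|ki] := eqVneq k (axis i); last by rewrite horner0 x0.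
have [p0|pn0] := eqVneq p 0%N; first by rewrite hornerX.
have pr0 : p%:R != 0 :> R by rewrite pnatr_eq0.
rewrite hornerZ hornerD hornerN hornerC hornerXn xb.
transitivity (sg i ^+ 2 * x 0 (axis i)); first by rewrite s1 mul1r.
by field.
Qed.

Definition curve_eq i p : mpoly.mpoly n R :=
  \sum_(k | (k != axis i) && (k != bend)) mpoly.mpolyX R (mpoly.mnm1 k) ^+ 2 +
  (mpoly.mpolyX R (mpoly.mnm1 bend) ^+ 2 - mpoly.mpolyC n (p%:R ^+ 2)
    - mpoly.mpolyC n (2 * p%:R * sg i) * mpoly.mpolyX R (mpoly.mnm1 (axis i))) ^+ 2.

Lemma curve_eqP i p x : mpoly.meval (x 0) (curve_eq i p) = 0 <-> on_curve i p x.
Proof.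
have evsq P : mpoly.meval (x 0) (P ^+ 2) = mpoly.meval (x 0) P ^+ 2 by rewrite rmorphXn.
have -> : mpoly.meval (x 0) (curve_eq i p) =
    \sum_(k | (k != axis i) && (k != bend)) x 0 k ^+ 2 +
    (x 0 bend ^+ 2 - p%:R ^+ 2 - 2 * p%:R * sg i * x 0 (axis i)) ^+ 2.
  rewrite mpoly.mevalD rmorph_sum /= evsq !mpoly.mevalB evsq mpoly.mevalM.
  rewrite !mpoly.mevalC !mpoly.mevalXU; congr (_ + _).
  by apply: eq_bigr => k _; rewrite evsq mpoly.mevalXU.
split=> [/eqP|[x0 xb]].
  rewrite paddr_eq0 ?sqr_ge0 ?sumr_ge0 //; last by move=> k _; exact: sqr_ge0.
  rewrite psumr_eq0; last by move=> k _; exact: sqr_ge0.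
  move=> /andP[/allP x0]; rewrite sqrf_eq0 subr_eq0 subr_eq => /eqP xb.
  split=> [k ki kb|]; last by rewrite xb addrC.
  have := x0 k (mem_index_enum _); rewrite ki kb /= sqrf_eq0.
  by move/eqP.
rewrite big1 => [|k /andP[ki kb]]; last by rewrite x0 // expr0n.
by rewrite xb add0r (_ : _ - _ - _ = 0) ?expr0n //; ring.
Qed.

Local Notation curve_index := ('I_r * 'I_(norm1 eta).+1)%type.

Lemma curve_ok_lt i p : curve_ok i p -> (p < (norm1 eta).+1)%N.
Proof.
move=> /andP[_ ph]; rewrite ltnS (leq_trans ph) //.
by apply: leq_trans (mult_le_norm1 i); lia.
Qed.

Lemma realization_algebraic : real_algebraic_set realization.
Proof.
exists [:: \prod_(c : curve_index | curve_ok c.1 c.2) curve_eq c.1 c.2].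
apply/seteqP; split=> x /=.
  move=> [i [p [ok xp]]] g; rewrite inE => /eqP ->.
  rewrite rmorph_prod; apply/eqP/prodf_eq0.
  exists (i, Ordinal (curve_ok_lt ok)) => //.
  by apply/eqP/curve_eqP.
move=> /(_ _ (mem_head _ _)); rewrite rmorph_prod => /eqP/prodf_eq0[[i p] /= ok].
by move=> /eqP/curve_eqP xp; exists i, p.
Qed.

Definition curve_param (c : curve_index) : mpoly.mpoly n R :=
  mpoly.mpolyX R (mpoly.mnm1 (if c.2 == 0%N :> nat then axis c.1 else bend)).

Lemma curve_paramE c :
  curve_pullback (fun c : curve_index => curve_coord c.1 c.2) c (curve_param c) = 'X.
Proof.
rewrite /curve_pullback /curve_param mpoly.mmapX mpoly.mmap1U /curve_coord.
have [p0|pn0] := eqVneq (c.2 : nat) 0%N; last by rewrite eqxx.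
by rewrite (negPf (axis_neq_bend _)) eqxx.
Qed.

Lemma realization_has_dim (U : set 'rV[R]_n) : open U -> realization `&` U !=set0 ->
  has_dim (realization `&` U) 1.
Proof.
move=> oU XU.
apply: (@has_dim_polynomial_curves R n curve_index
  (fun c => curve_coord c.1 c.2) curve_param curve_paramE _
  (fun c => [set s | curve_ok c.1 c.2 /\ U (\row_k (curve_coord c.1 c.2 k).[s])])) => //.
  move=> x; split=> [[[i [p [ok /on_curveP[s xs]]]] Ux]|[[i p] [s [[/= ok Us] xs]]]].
    by exists (i, Ordinal (curve_ok_lt ok)), s; split=> //; split=> //=; rewrite /= -xs; exact: Ux.
  split; last by rewrite xs.
  by exists i, p; split=> //; apply/on_curveP; exists s.
move=> [i p] [s0 /= [ok Us0]] f f0.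
have : \forall s \near s0, U (\row_k (curve_coord i p k).[s]).
  have : (fun s => \row_k (curve_coord i p k).[s]) @ s0 -->
      (\row_k (curve_coord i p k).[s0] : 'rV[R]_n).
    apply: row_cvg => k; rewrite mxE; under eq_fun do rewrite mxE.
    by apply: cvg_horner; exact: cvg_id.
  by apply; exact: open_nbhs_nbhs.
move=> /nbhs_ballP[e /= e0 He].
apply: (@poly_eq0_on_ball R f s0 e e0) => s sb; apply: f0; split=> //.
exact: (He s sb).
Qed.

Hypothesis eta_gt0 : forall i, (0 < mult i)%N.
Hypothesis eta_even : ~~ odd (norm1 eta).
Hypothesis r_gt0 : (0 < r)%N.

Definition end_index := {i : 'I_r & 'I_(mult i)}.
HB.instance Definition _ := Finite.on end_index.

Definition end_arc (j : end_index) t : 'rV[R]_n :=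
  end_point (tag j) (uphalf (end_code (tagged j))) (odd (end_code (tagged j))) t.

Definition end_radius : R := (norm1 eta).+1%:R^-1.

Lemma end_radius_gt0 : 0 < end_radius.
Proof. by rewrite invr_gt0 ltr0Sn. Qed.

Lemma curve_ok_small i p t : curve_ok i p -> 0 < t -> t < end_radius ->
  0 <= p%:R * t < 1.
Proof.
move=> ok t0 tt; rewrite mulr_ge0 ?(ltW t0) //=.
have := curve_ok_lt ok; rewrite ltnS => pN.
have : t * (norm1 eta).+1%:R < 1 by rewrite -ltr_pdivlMr ?ltr0Sn // div1r.
apply: le_lt_trans; rewrite mulrC ler_wpM2l ?(ltW t0) // ler_nat.
by rewrite (leq_trans pN).
Qed.

Lemma realization_arcs v t : 0 < t -> t < end_radius ->
  (rho_infty_preimage realization (v, t) <-> exists j, v = end_arc j t).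
Proof.
move=> t0 tr; rewrite rho_infty_preimageE //; split=> [[v1 [i [p [ok onc]]]]|[[i l] ->]].
  have [[q vE]|[p0 vE]] := on_curve_end_point t0 v1 onc.
    have [||l [lp lq]] := @end_code_surj eta i p (if p == 0%N then false else q) => //.
      by case: eqVneq.
    exists (Tagged (fun i => 'I_(mult i)) l); rewrite vE /end_arc /= lp lq.
    case: eqVneq => // ->; apply/rowP => k.
    by rewrite !mxE !mul0r sqrtr0 !mulr0.
  have oi : odd (mult i).
    by move: ok; rewrite p0 /curve_ok leqn0 eqb0 negbK => /andP[].
  have [i' [oi' ai si]] := opposite_position eta_even oi.
  have ok' : curve_ok i' 0 by rewrite /curve_ok oi'.
  have [//|l [lp lq]] := @end_code_surj eta i' 0 false ok'.
  exists (Tagged (fun i => 'I_(mult i)) l); rewrite vE /end_arc /= lp lq.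
  apply/rowP => k; rewrite !mxE !mul0r sqrtr0 !mulr0 mul0r addr0 subr0 mul1r.
  rewrite (_ : axis i' = axis i); last by rewrite /axis ai.
  congr (_ * _); rewrite -[RHS]/((-1) ^+ axis_sign i') -[sg i]/((-1) ^+ axis_sign i) si.
  by case: axis_sign; rewrite ?expr0 ?expr1 ?opprK.
have ok := end_curve_ok l.
have /andP[pt0 pt1] := curve_ok_small ok t0 tr.
have pt2 : (uphalf (end_code l))%:R * t <= 2 by lra.
split; first by rewrite end_point_unit // pt0.
exists i, (uphalf (end_code l)); split=> //.
exact: end_point_on_curve.
Qed.

Lemma end_arc_inj t : 0 < t -> t < end_radius -> injective (fun j => end_arc j t).
Proof.
move=> t0 tr [i l] [i' l'] /=; rewrite /end_arc /= => ee.
have /andP[_ pt] := curve_ok_small (end_curve_ok l) t0 tr.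
have /andP[_ pt'] := curve_ok_small (end_curve_ok l') t0 tr.
have [ii' pp' qq'] := end_point_inj t0 pt pt' ee.
case: _ / ii' l' ee pt' pp' qq' => l' _ _ pp' qq'.
by rewrite (end_code_inj pp' qq').
Qed.

Lemma card_end_index i : #|[pred j : end_index | direction (tag j) == direction i]| = mult i.
Proof.
rewrite -[RHS]card_ord -(card_codom (f := fun l : 'I_(mult i) =>
  Tagged (fun i => 'I_(mult i)) l : end_index)); last first.
  by move=> l l' /eqP; rewrite eq_Tagged => /eqP.
apply: eq_card => -[i' l]; rewrite inE /=; apply/eqP/codomP => [/direction_inj ii'|[l' /(congr1 tag) /= ->] //].
by case: _ / ii' in l *; exists l.
Qed.

Theorem realization_realizes : sorted leq eta -> algebraically_realizable R eta.
Proof.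
move=> eta_sorted; exists n, realization.
have Y_gt0 z : rho_infty_preimage realization z -> 0 < z.2 by case.
have arcs_cont (j : end_index) t : 0 < t -> t < end_radius -> end_arc j @ t --> end_arc j t.
  by move=> _ _; exact: end_point_continuous.
have arcs_lim (j : end_index) : end_arc j t @[t --> 0^'+] --> direction (tag j).
  exact: end_point_lim.
have clE := closure_arcs end_radius_gt0 Y_gt0 realization_arcs arcs_lim.
have germE := germ_components_arcs end_radius_gt0 Y_gt0 realization_arcs
  end_arc_inj arcs_cont arcs_lim.
pose i0 := Ordinal r_gt0; pose j0 : end_index := Tagged _ (Ordinal (eta_gt0 i0)).
have XN0 t : 0 < t -> t < end_radius -> realization (t^-1 *: end_arc j0 t) /\
    sqnorm (t^-1 *: end_arc j0 t) = t ^- 2.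
  move=> t0 tr; have : rho_infty_preimage realization (end_arc j0 t, t).
    by apply/realization_arcs => //; exists j0.
  rewrite rho_infty_preimageE // => -[v1 Xv]; split=> //.
  by rewrite sqnormZ v1 mulr1 exprVn.
split.
- split; first exact: realization_algebraic.
  split.
    rewrite -[realization]setIT; apply: realization_has_dim; first exact: openT.
    have [||Xx _] := XN0 (end_radius / 2).
    + by rewrite divr_gt0 // end_radius_gt0.
    + by rewrite ltr_pdivrMr // ltr_pMr ?ltr1n // end_radius_gt0.
    + by eexists; split; first exact: Xx.
  move=> x Xx; near=> e; apply: realization_has_dim; first exact: ball_open.
  by exists x; split=> //; apply: ballxx; near: e; exact: nbhs_right_gt.
- move=> /bounded_set_sqnormP[M XM].
  pose t := Num.min end_radius (`|M| + 2)^-1 / 2.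
  have M0 : 0 < `|M| + 2 by rewrite ltr_wpDl.
  have m0 : 0 < Num.min end_radius (`|M| + 2)^-1 by rewrite lt_min end_radius_gt0 invr_gt0.
  have t0 : 0 < t by rewrite divr_gt0.
  have /andP[tr tM] : (t < end_radius) && (t < (`|M| + 2)^-1).
    by rewrite -lt_min ltr_pdivrMr // ltr_pMr ?ltr1n.
  have [Xt st] := XN0 t t0 tr; have := XM _ Xt; rewrite st leNgt => /negP; apply.
  have tinv : `|M| + 2 < t^-1 by rewrite -[ltLHS]invrK ltf_pV2 // posrE invr_gt0.
  rewrite -exprVn; have := ler_norm M; have := normr_ge0 M; nra.
- pose s := [seq direction i | i <- enum 'I_r].
  have ss : size s = r by rewrite size_map size_enum_ord.
  have nths i : nth 0 s i = direction i.
    by rewrite (nth_map i) ?size_enum_ord // nth_ord_enum.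
  exists s; split=> //.
  + by rewrite map_inj_uniq ?enum_uniq //; exact: direction_inj.
  + apply/seteqP; split=> [[v t] /boundary_inftyE[-> _ /clE[j <-]]|_ [a /mapP[i _ ->] <-]].
      by exists (direction (tag j)) => //=; apply/mapP; exists (tag j); rewrite ?mem_enum.
    apply/boundary_inftyE; split=> //; first exact/unit_sphereE/direction_unit.
    by apply/clE; exists (Tagged (fun i => 'I_(mult i)) (Ordinal (eta_gt0 i))).
  + move=> k; rewrite ss => kr; have := germE (direction (Ordinal kr)).
    by rewrite card_end_index -(nths (Ordinal kr)).
Unshelve. all: by end_near. Qed.

End RealizationInvariant.

Local Close Scope ring_scope.
Local Close Scope classical_set_scope.

Theorem proposition3p7 (R : realType) (eta : seq nat) (heta : calN eta) :
  algebraically_realizable R eta <-> norm1 eta = 0 %[mod 2].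
Proof.
have -> : (norm1 eta = 0 %[mod 2]) <-> ~~ odd (norm1 eta).
  by rewrite modn2 mod0n; case: odd; split.
case: heta => eta_gt0 /allP eta1 eta_sorted; split.
  move=> [n [X [[algX [dimX _]] unbX kX]]].
  exact: even_norm1_k_infty algX dimX.2 unbX kX.
move=> ev; apply: realization_realizes => // i.
by apply: eta1; rewrite mem_nth.
Qed.
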